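(* $\lambda_5(n,m)=\Omega\big(n\alpha(n,m)2^{\alpha(n,m)}\big)$ and $\lambda_5(n)=\Omega\big(n\alpha(n)2^{\alpha(n)}\big)$.
   Context: A sequence contains an alternation of length $7$ if there are distinct symbols $a\ne b$ and indices $i_1<\dots<i_7$ whose entries are $a,b,a,b,a,b,a$. $\lambda_5(n)$ is the maximum length of a sequence using at most $n$ distinct symbols with no two consecutive equal entries and no alternation of length $7$. A block is a sequence of pairwise distinct symbols; $\lambda_5(n,m)$ is the maximum length of a sequence using at most $n$ distinct symbols, with no alternation of length 7, that is a concatenation of at most $m$ blocks. Ackermann's function: $a_{1,j}=2^j$, $a_{i,1}=2$ ($i\ge2$), $a_{i,j}=w\cdot a_{i-1,w}$ with $w=a_{i,j-1}$ ($i,j\ge2$); $\alpha(n,m)=\min\{i: a_{i,j}\ge m,\ j=\max\{\lceil n/m\rceil,3\}\}$, $\alpha(n)=\alpha(n,n)$. *)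

(* Defs.v *)
From mathcomp Require Import all_boot.
Set Implicit Arguments. Unset Strict Implicit. Unset Printing Implicit Defensive.

Definition has_alt7 (s : seq nat) : Prop :=
  exists a b : nat, a != b /\ subseq [:: a; b; a; b; a; b; a] s.

Definition at_most_symbols (n : nat) (s : seq nat) : Prop :=
  size (undup s) <= n.

Definition no_repeat (s : seq nat) : Prop :=
  forall i, i.+1 < size s -> nth 0 s i != nth 0 s i.+1.

Definition m_block (m : nat) (s : seq nat) : Prop :=
  exists bs : seq (seq nat), [/\ size bs <= m, all uniq bs & flatten bs = s].

Definition DS5 (n : nat) (s : seq nat) : Prop :=
  [/\ at_most_symbols n s, no_repeat s & ~ has_alt7 s].

Definition DS5_blocks (n m : nat) (s : seq nat) : Prop :=
  [/\ at_most_symbols n s, m_block m s & ~ has_alt7 s].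

Definition lambda5_ge (n L : nat) : Prop :=
  exists s, DS5 n s /\ L <= size s.

Definition lambda5_nm_ge (n m L : nat) : Prop :=
  exists s, DS5_blocks n m s /\ L <= size s.

(* Ackermann's function a_{i,j} (meaningful for i, j >= 1):
   a_{1,j} = 2^j, a_{i,1} = 2 (i >= 2), a_{i,j} = w * a_{i-1,w}, w = a_{i,j-1}. *)
Fixpoint ack (i j : nat) {struct i} : nat :=
  match i with
  | 0 => 2 ^ j (* dummy, unused *)
  | 1 => 2 ^ j
  | i'.+1 =>
      (fix aux (j : nat) : nat :=
         match j with
         | 0 => 2 (* dummy, unused *)
         | 1 => 2
         | j'.+1 => let w := aux j' in w * ack i' w
         end) j
  end.

Definition ceil_div (n m : nat) : nat := (n + m.-1) %/ m.

(* alpha(n,m) = min { i >= 1 : a_{i,j} >= m }, j = max(ceil(n/m), 3).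
   Computed as a bounded search over i in 1..m+1; the minimum always
   lies in this range because a_{i,j} >= a_{i,2} = 2^(i+1) > i for j >= 2. *)
Definition alpha2 (n m : nat) : nat :=
  let j := maxn (ceil_div n m) 3 in
  (find (fun k => m <= ack k.+1 j) (iota 0 m.+1)).+1.

Definition alpha (n : nat) : nat := alpha2 n n.

(* Main.v *)
Require Import Defs.
From mathcomp Require Import all_boot.
From mathcomp Require Import zify.
Set Implicit Arguments. Unset Strict Implicit. Unset Printing Implicit Defensive.

(* A sequence of blocks of a common length is enlarged by shuffling: given [sub], whose
   blocks have length w, and [bot], which has w blocks, insert the w symbols of the k-th
   block of [sub] at the ends of the w blocks of the k-th of many disjoint copies of [bot].
   Two symbols then share at most one block, and if b precedes a in it, the sequence around
   that block reads a* b* [b a] b* a* (this is [nested]).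

   Order 4, multiplicity 2^i: replace each block B of the level i-1 sequence by B, rev B and
   shuffle; a nested pair becomes a* b* (b a)(a b) b* a*, without an alternation of length 6.

   Order 5: in each block of the level i-1 sequence, replace the set of symbols that make
   their last occurrence there by an order-4 sequence U of multiplicity 2^i, and double the
   other symbols as before. A pair that is replaced by U reads a* b* U(a,b), which has no
   alternation of length 7 if b disappears last in U(a,b). The average multiplicity satisfies
   c_i = 2 c_(i-1) + 2^i - O(1), so c_i is of order i 2^i. Symbols that do not fill up a copy
   of U (or a block of length w) are deleted, which costs little when the blocks of the
   level i-1 sequence are long. *)

(** * Alternation length of a pair of symbols *)

(* The greedy scan gives the length of the longest subsequence a, b, a, ... of [s]. *)
Fixpoint alt_len (a b : nat) (s : seq nat) : nat :=
  if s is x :: s' then if x == a then (alt_len b a s').+1 else alt_len a b s' else 0.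

(** Deleting the first term of an alternation that starts with [a] leaves one that starts with
    [b]. *)
Lemma alt_len_swap a b s : alt_len a b s <= (alt_len b a s).+1.
Proof.
elim: s a b => //= x s IH a b.
have [->|_] := eqVneq x a; last by case: ifP => _; [lia | exact: IH].
by have [->|_] := eqVneq a b; rewrite ?ltnS // leqW.
Qed.

(** The parity of the greedy length on [s] tells which of the two symbols is awaited when the scan
    enters [t]. *)
Lemma alt_len_cat a b s t :
  alt_len a b (s ++ t) = alt_len a b s + (if odd (alt_len a b s) then alt_len b a t else alt_len a b t).
Proof.
elim: s a b => //= x s IH a b; case: ifP => _ /=; rewrite IH //.
by rewrite addSn; case: (odd (alt_len b a s)).
Qed.

Lemma alt_len_notin a b s : a \notin s -> alt_len a b s = 0.
Proof.
elim: s => //= x s IH; rewrite inE negb_or eq_sym => /andP[/negPf-> /IH //].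
Qed.

Lemma alt_len_notin2 a b s : b \notin s -> alt_len a b s <= 1.
Proof. by move=> /(alt_len_notin a) bs; have := alt_len_swap a b s; rewrite bs. Qed.

Lemma alt_len_in a b s : a \in s -> 0 < alt_len a b s.
Proof.
elim: s => //= x s IH; rewrite inE eq_sym.
by have [//|_ /= /IH] := eqVneq x a.
Qed.

Lemma alt_len_only a b s : a \in s -> b \notin s -> alt_len a b s = 1.
Proof. by move=> /(alt_len_in b) ? /(alt_len_notin2 a) ?; lia. Qed.

Lemma alt_len_gt1 a b s : 1 < alt_len a b s -> a \in s /\ b \in s.
Proof.
move=> h; split; apply: contraLR h => hn; rewrite -leqNgt.
  by rewrite (alt_len_notin _ hn).
exact: alt_len_notin2.
Qed.

(** Every other term of the alternation is an [a], beginning with the first. *)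
Lemma alt_len_count a b s : alt_len a b s <= 2 * count_mem a s.
Proof.
elim: s => //= x s IH; case: eqP => _ //=; have := alt_len_swap b a s; lia.
Qed.

Lemma alt_len_filter (P : pred nat) a b s :
  P a -> P b -> alt_len a b (filter P s) = alt_len a b s.
Proof.
move=> + +; elim: s a b => //= x s IH a b Pa Pb.
have [->|xa] := eqVneq x a; first by rewrite Pa /= eqxx IH.
by case: ifP => _ /=; rewrite ?(negPf xa) IH.
Qed.

(** Injectivity is asked only on [S], because the renaming in [relabel] is injective only on the
    symbols of [U]. *)
Lemma alt_len_map (S : pred nat) (f : nat -> nat) a b s :
  {in S &, injective f} -> a \in S -> b \in S -> {subset s <= S} ->
  alt_len (f a) (f b) (map f s) = alt_len a b s.
Proof.
move=> finj; elim: s a b => //= x s IH a b aS bS sS.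
have xS : x \in S by apply: sS; rewrite inE eqxx.
have sS' : {subset s <= S} by move=> y ys; apply: sS; rewrite inE ys orbT.
by rewrite (inj_in_eq finj) // !IH.
Qed.

Lemma alt_len_cons a b x s : alt_len a b s <= alt_len a b (x :: s).
Proof. by rewrite /=; case: ifP => // _; exact: alt_len_swap. Qed.

Lemma alt_len_subseq a b s t : subseq s t -> alt_len a b s <= alt_len a b t.
Proof.
elim: t s a b => [|y t IH] [|x s] a b //.
rewrite [subseq _ _]/=; case: eqP => [->|_] st.
  by rewrite /=; case: ifP => _; rewrite ?ltnS IH.
by apply: leq_trans (alt_len_cons _ _ _ _); apply: IH.
Qed.

Lemma alt_len_uniq_filter a b s : a != b -> uniq s -> 1 < alt_len b a s ->
  [seq x <- s | pred2 a b x] = [:: b; a].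
Proof.
move=> ab; elim: s => //= x s IH /andP[xs us].
have [xb|xb] := eqVneq x b.
  subst x; rewrite eq_sym (negPf ab) /= ltnS => h; congr (_ :: _).
  have ain : a \in s by apply: contraLR h => ?; rewrite alt_len_notin.
  rewrite -(filter_pred1_uniq us ain); apply: eq_in_filter => y ys /=.
  by have [yb|//] := eqVneq y b; [rewrite -yb ys in xs | rewrite orbF].
have [xa /=|xa /= h] := eqVneq x a; last exact: IH.
by subst x => h; have := alt_len_notin2 b xs; lia.
Qed.

Lemma alt_len_total a b s : a != b -> a \in s -> b \in s -> 1 < alt_len a b s \/ 1 < alt_len b a s.
Proof.
move=> ab; elim: s => //= x s IH; rewrite !inE.
have [xa|xa] := eqVneq x a.
  subst x; rewrite (eq_sym b a) (negPf ab) /= => _ bs; left.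
  by rewrite ltnS alt_len_in.
have [xb|xb] := eqVneq x b; last first.
  by move=> /= aS bS; exact: IH.
subst x; rewrite /= => as_ _; right; by rewrite ltnS alt_len_in.
Qed.

Lemma alt_len_index a b s : a != b -> uniq s -> 1 < alt_len a b s -> index a s < index b s.
Proof.
move=> ab; elim: s => //= x s IH /andP[xs us].
have [xa|xa] := eqVneq x a; first by subst x; rewrite (negPf ab).
have [xb|xb] := eqVneq x b; last by move=> h; rewrite ltnS IH.
by subst x => h; have := alt_len_notin2 a xs; lia.
Qed.

(** [undup] keeps last occurrences, so the hypothesis on indices says that [b] disappears after [a].
    A longest alternation then ends in [b], which fixes its parity. *)
Lemma alt_len_undup_odd a b s : a != b -> b \in s -> index a (undup s) < index b (undup s) ->
  ~~ odd (alt_len a b s) /\ odd (alt_len b a s).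
Proof.
move=> ab; elim: s => //= x s IH; rewrite inE.
case: ifP => xs.
  move=> bs h; have {}bs : b \in s by case/orP: bs => [/eqP->|].
  have [h1 h2] := IH bs h.
  have [xa|xa] := eqVneq x a; first by subst x; rewrite (negPf ab) /= h2.
  by have [xb|xb] := eqVneq x b; split=> //=.
rewrite /=.
have [xa|xa] := eqVneq x a.
  subst x; rewrite (negPf ab) eq_sym (negPf ab) /= => bs _.
  by rewrite alt_len_only // xs.
by have [xb|xb] //= := eqVneq x b.
Qed.

(** * Nested block sequences and the invariant of the induction *)

(* For a block that is free of repetitions, [1 < alt_len b a B] means that [b] precedes [a] in [B]. *)
Definition nested (bs : seq (seq nat)) : Prop :=
  forall pre B post a b, bs = pre ++ B :: post -> a != b -> 1 < alt_len b a B ->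
  alt_len b a (flatten pre) <= 1 /\ alt_len a b (flatten post) <= 1.

Definition alt_le (M : nat) (s : seq nat) : Prop :=
  forall a b, a != b -> alt_len a b s <= M.

Definition nsym (s : seq nat) : nat := size (undup s).

(** [c] is a lower bound for the average multiplicity of a symbol. The number of blocks is left
    open; it is bounded separately through [ack]. *)
Definition good (c M j : nat) (bs : seq (seq nat)) : Prop :=
  [/\ all uniq bs, all (fun B => size B == j) bs, nested bs, alt_le M (flatten bs)
    & c * nsym (flatten bs) <= size (flatten bs)].

Lemma size_flatten_const (T : Type) w (bs : seq (seq T)) :
  all (fun B => size B == w) bs -> size (flatten bs) = size bs * w.
Proof.
elim: bs => //= B bs IH /andP[/eqP Bw /IH h]; by rewrite size_cat Bw h mulSn.
Qed.

(** Blocks of length 0 contain no symbols, so every multiplicity is attained; this starts the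
    induction on the block length. *)
Lemma good_nil c M : good c M 0 [:: [::]].
Proof.
split=> //; last by rewrite /nsym /= muln0.
move=> [|p pre] B post a b //=; last by case: pre => [|? ?] [].
by case=> <-.
Qed.

Lemma good_one M j : 1 < M -> good 1 M j [:: iota 0 j].
Proof.
move=> M1; split=> //=.
- by rewrite iota_uniq.
- by rewrite size_iota eqxx.
- by move=> [|p pre] B post a b //=; [case=> _ <- | case: pre => [|? ?] []].
- move=> a b _; rewrite cats0; apply: leq_trans (alt_len_count _ _ _) _.
  have := count_uniq_mem a (iota_uniq 0 j); case: (a \in _) => -> //; lia.
- by rewrite cats0 /nsym undup_id ?iota_uniq // mul1n.
Qed.

(** * Shuffling *)

(** Symbols are natural numbers, so the disjoint union of the alphabet of [sub] with numbered copies
    of that of [bot] is coded through [pickle]. *)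
Definition enc_top (x : nat) : nat := pickle (inl x : nat + nat * nat).
Definition enc_bot (k y : nat) : nat := pickle (inr (k, y) : nat + nat * nat).

Definition is_top (z : nat) : bool :=
  if unpickle z : option (nat + nat * nat) is Some (inl _) then true else false.
Definition is_bot (k z : nat) : bool :=
  if unpickle z : option (nat + nat * nat) is Some (inr (k', _)) then k' == k else false.

Lemma enc_top_inj : injective enc_top.
Proof. by move=> x y /(pcan_inj pickleK) []. Qed.
Lemma enc_bot_inj2 k y k' y' : enc_bot k y = enc_bot k' y' -> k = k' /\ y = y'.
Proof. by move=> /(pcan_inj pickleK) []. Qed.
Lemma enc_bot_inj k : injective (enc_bot k).
Proof. by move=> x y /enc_bot_inj2[]. Qed.
Lemma enc_top_bot x k y : enc_top x <> enc_bot k y.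
Proof. by move=> /(pcan_inj pickleK). Qed.
Lemma is_top_top x : is_top (enc_top x).
Proof. by rewrite /is_top pickleK. Qed.
Lemma is_top_bot k x : is_top (enc_bot k x) = false.
Proof. by rewrite /is_top pickleK. Qed.
Lemma is_bot_bot k k' x : is_bot k (enc_bot k' x) = (k' == k).
Proof. by rewrite /is_bot pickleK. Qed.
Lemma is_bot_top k x : is_bot k (enc_top x) = false.
Proof. by rewrite /is_bot pickleK. Qed.

Fixpoint insert (xs : seq nat) (cs : seq (seq nat)) : seq (seq nat) :=
  match xs, cs with
  | x :: xs', c :: cs' => rcons c x :: insert xs' cs'
  | _, _ => cs
  end.

Definition bot_copy k bot := map (map (enc_bot k)) bot.

(** The counter [k] numbers the copies of [bot]. If all blocks of [sub] are empty, the result is a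
    plain concatenation of disjoint copies. *)
Fixpoint shuffle (bot : seq (seq nat)) (k : nat) (sub : seq (seq nat)) : seq (seq nat) :=
  if sub is B :: sub' then
    insert (map enc_top B) (bot_copy k bot) ++ shuffle bot k.+1 sub'
  else [::].

Lemma size_insert xs cs : size (insert xs cs) = size cs.
Proof. by elim: xs cs => [|x xs IH] [|c cs] //=; rewrite IH. Qed.

Lemma count_insert P xs cs : size xs <= size cs ->
  count P (flatten (insert xs cs)) = count P xs + count P (flatten cs).
Proof.
elim: xs cs => [|x xs IH] [|c cs] //=; rewrite ltnS => h.
by rewrite !count_cat IH // -cats1 count_cat /=; lia.
Qed.

Lemma count_insert_le P xs cs :
  count P (flatten (insert xs cs)) <= count P xs + count P (flatten cs).
Proof.
elim: xs cs => [|x xs IH] [|c cs] //=.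
rewrite !count_cat -cats1 count_cat /=; have := IH cs; lia.
Qed.

Lemma mem_insert xs cs z : z \in flatten (insert xs cs) ->
  z \in xs \/ z \in flatten cs.
Proof.
elim: xs cs => [|x xs IH] [|c cs] //=; first by right.
rewrite !mem_cat mem_rcons !inE; case/orP => [/orP[->|->]|/IH[->|->]]; rewrite ?orbT; by [left | right].
Qed.

Lemma filter_insert0 (P : pred nat) xs cs : {in xs, forall x, ~~ P x} ->
  filter P (flatten (insert xs cs)) = filter P (flatten cs).
Proof.
elim: xs cs => [|x xs IH] [|c cs] //= xP.
rewrite !filter_cat filter_rcons (negPf (xP x (mem_head _ _))) IH // => y ys.
by apply: xP; rewrite inE ys orbT.
Qed.

Lemma filter_insert1 (P : pred nat) xs cs : size xs <= size cs ->
  {in xs, forall x, P x} -> {in flatten cs, forall x, ~~ P x} ->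
  filter P (flatten (insert xs cs)) = xs.
Proof.
elim: xs cs => [|x xs IH] [|c cs] //=.
  by move=> _ _ cP; rewrite (@eq_in_filter _ P pred0) ?filter_pred0 // => y /cP /negPf.
rewrite ltnS => h xP cP.
rewrite filter_cat filter_rcons (xP x (mem_head _ _)) IH //; first last.
- by move=> y ys; apply: cP; rewrite mem_cat ys orbT.
- by move=> y ys; apply: xP; rewrite inE ys orbT.
rewrite (_ : filter P c = [::]) //; apply/eqP; rewrite -[_ == _]negbK -has_filter.
by apply/hasPn => y ys; apply: cP; rewrite mem_cat ys.
Qed.

Lemma flatten_bot_copy k bot : flatten (bot_copy k bot) = map (enc_bot k) (flatten bot).
Proof. by rewrite /bot_copy map_flatten. Qed.

Lemma size_shuffle bot k sub : size (shuffle bot k sub) = size sub * size bot.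
Proof.
by elim: sub k => //= B sub IH k; rewrite size_cat size_insert IH size_map mulSn.
Qed.

Lemma size_flatten_shuffle bot k sub : all (fun B => size B <= size bot) sub ->
  size (flatten (shuffle bot k sub)) =
  size (flatten sub) + size sub * size (flatten bot).
Proof.
elim: sub k => //= B sub IH k /andP[Bb sb]; rewrite flatten_cat !size_cat IH //.
rewrite -(count_predT (flatten (insert _ _))) count_insert ?size_map ?size_map //.
by rewrite !count_predT flatten_bot_copy !size_map; lia.
Qed.

Lemma insert_all_uniq_size j xs cs k : all uniq cs -> all (fun B => size B == j) cs ->
  size xs = size cs ->
  all uniq (insert (map enc_top xs) (bot_copy k cs)) /\
  all (fun B => size B == j.+1) (insert (map enc_top xs) (bot_copy k cs)).
Proof.
elim: xs cs => [|x xs IH] [|c cs] //= /andP[uc ucs] /andP[sc scs] [h].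
have [-> ->] := IH cs ucs scs h.
rewrite rcons_uniq size_rcons size_map eqSS sc (map_inj_uniq (@enc_bot_inj k)) uc !andbT.
by split=> //; apply/mapP => -[y _ /enc_top_bot].
Qed.

Lemma shuffle_all_size j bot k sub : all uniq bot -> all (fun B => size B == j) bot ->
  all (fun B => size B == size bot) sub ->
  all uniq (shuffle bot k sub) /\ all (fun B => size B == j.+1) (shuffle bot k sub).
Proof.
move=> ub sb; elim: sub k => //= B sub IH k /andP[/eqP sB ss].
have [h1 h2] := insert_all_uniq_size k ub sb sB; have [h3 h4] := IH k.+1 ss.
by rewrite !all_cat h1 h2 h3 h4.
Qed.

Lemma shuffle_uniq bot k sub : all uniq bot -> all uniq (shuffle bot k (nseq sub [::])).
Proof.
move=> ub; elim: sub k => //= n IH k; rewrite all_cat IH andbT.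
case: bot ub {IH} => //= b bs /andP[u us]; rewrite (map_inj_uniq (@enc_bot_inj k)) u /=.
by rewrite /bot_copy all_map; apply: sub_all us => s /=; rewrite (map_inj_uniq (@enc_bot_inj k)).
Qed.

Lemma mem_shuffle bot k sub z : z \in flatten (shuffle bot k sub) ->
  (exists2 x, x \in flatten sub & z = enc_top x) \/
  (exists k' y, [/\ k <= k' < k + size sub, y \in flatten bot & z = enc_bot k' y]).
Proof.
elim: sub k => //= B sub IH k; rewrite flatten_cat mem_cat => /orP[/mem_insert[|]|/IH].
- by case/mapP=> x xB ->; left; exists x => //; rewrite mem_cat xB.
- rewrite flatten_bot_copy => /mapP[y yb ->]; right; exists k, y; split=> //; lia.
- case=> [[x xs ->]|[k' [y [h yb ->]]]].
    by left; exists x => //; rewrite mem_cat xs orbT.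
  by right; exists k', y; split=> //; lia.
Qed.

Lemma nsym_shuffle bot sub : nsym (flatten (shuffle bot 0 sub)) <=
  nsym (flatten sub) + size sub * nsym (flatten bot).
Proof.
rewrite /nsym; set t := map enc_top (undup (flatten sub)) ++
  [seq enc_bot k y | k <- iota 0 (size sub), y <- undup (flatten bot)].
have -> : size (undup (flatten sub)) + size sub * size (undup (flatten bot)) = size t.
  by rewrite size_cat size_map size_allpairs size_iota.
apply: uniq_leq_size; first exact: undup_uniq.
move=> z; rewrite mem_undup => /mem_shuffle[[x xs ->]|[k [y [/andP[_ h] yb ->]]]].
  by rewrite mem_cat map_f // mem_undup.
rewrite mem_cat; apply/orP; right; apply/allpairsP; exists (k, y); split=> //=.
  by rewrite mem_iota.
by rewrite mem_undup.
Qed.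

Lemma filter_top_shuffle bot k sub : all (fun B => size B <= size bot) sub ->
  filter is_top (flatten (shuffle bot k sub)) = map enc_top (flatten sub).
Proof.
elim: sub k => //= B sub IH k /andP[hB hs].
rewrite flatten_cat filter_cat IH // filter_insert1 ?size_map ?map_cat //.
  by move=> x /mapP[y _ ->]; rewrite is_top_top.
by move=> x; rewrite flatten_bot_copy => /mapP[y _ ->]; rewrite is_top_bot.
Qed.

Lemma cat_eq_mid (T : Type) (s t pre post : seq T) x : s ++ t = pre ++ x :: post ->
  (exists post', s = pre ++ x :: post' /\ post = post' ++ t) \/
  (exists pre', t = pre' ++ x :: post /\ pre = s ++ pre').
Proof.
elim: s pre => [|y s IH] [|p pre] /=.
- by move=> ->; right; exists [::].
- by move=> ->; right; exists (p :: pre).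
- by case=> -> <-; left; exists s.
case=> -> E; case: (IH _ E) => [[post' [-> ->]]|[pre' [-> ->]]]; first by left; exists post'.
by right; exists pre'.
Qed.

(** [o] holds the symbol inserted into the block and is empty once the symbols have run out. *)
Lemma insert_mid xs cs pre B post : insert xs cs = pre ++ B :: post ->
  exists p c q xs1 o xs2, [/\ cs = p ++ c :: q, xs = xs1 ++ o ++ xs2, size o <= 1 &
    [/\ pre = insert xs1 p, B = c ++ o & post = insert xs2 q]].
Proof.
elim: cs xs pre => [|c cs IH] [|x xs] pre /=; try by case: pre.
  move=> h; exists pre, B, post, [::], [::], [::]; split=> //; split=> //.
  by rewrite cats0.
case: pre => [|p pre] /= [h1 h2].
  by exists [::], c, cs, [::], [:: x], xs; split=> //; rewrite -h1 -h2 cats1.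
have [p' [c' [q [xs1 [o [xs2 [e1 e2 e3 [e4 e5 e6]]]]]]]] := IH _ _ h2.
exists (c :: p'), c', q, (x :: xs1), o, xs2; split=> //=.
- by rewrite e1.
- by rewrite e2.
- by split=> //; rewrite -h1 e4.
Qed.

(** The copies have distinct numbers, so the symbols with tag [k] stay within one stretch; the bound
    [k0 <= k] carries the induction. *)
Lemma shuffle_mid bot k0 sub pre B post : shuffle bot k0 sub = pre ++ B :: post ->
  exists k s1 s2 X pre' post',
  [/\ X \in sub, pre = s1 ++ pre', post = post' ++ s2,
      insert (map enc_top X) (bot_copy k bot) = pre' ++ B :: post' &
      [/\ forall y, enc_bot k y \notin flatten s1, forall y, enc_bot k y \notin flatten s2
        & k0 <= k]].
Proof.
elim: sub k0 pre => [|X sub IH] k0 pre /=; first by case: pre.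
move=> E; case: (cat_eq_mid E) => [[post' [e1 e2]]|[pre' [e1 e2]]].
  exists k0, [::], (shuffle bot k0.+1 sub), X, pre, post'; split=> //.
    by rewrite mem_head.
  split=> // y; apply/negP => /mem_shuffle[[x _ /esym/enc_top_bot //]|].
  by case=> k' [y' [h _ /enc_bot_inj2[e _]]]; lia.
have [k [s1 [s2 [Y [p' [q' [h1 h2 h3 h4 [h5 h6 h7]]]]]]]] := IH _ _ e1.
exists k, (insert (map enc_top X) (bot_copy k0 bot) ++ s1), s2, Y, p', q'; split=> //.
- by rewrite inE h1 orbT.
- by rewrite e2 h2 catA.
split=> //; last exact: ltnW.
move=> y; rewrite flatten_cat mem_cat negb_or h5 andbT; apply/negP => /mem_insert[].
  by case/mapP=> x _ /esym/enc_top_bot.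
rewrite flatten_bot_copy => /mapP[y' _ /enc_bot_inj2[e _]]; lia.
Qed.

Lemma alt_len_mid a b s1 s2 s3 : a \notin s1 -> b \notin s1 -> a \notin s3 -> b \notin s3 ->
  alt_len a b (s1 ++ s2 ++ s3) = alt_len a b s2.
Proof.
move=> a1 b1 a3 b3; rewrite !alt_len_cat !(alt_len_notin _ a1) /= !(alt_len_notin _ a3) !(alt_len_notin _ b3).
by rewrite if_same addn0.
Qed.

Lemma alt_len_insert_bot k X cs a b : 
  alt_len (enc_bot k a) (enc_bot k b) (flatten (insert (map enc_top X) (bot_copy k cs))) =
  alt_len a b (flatten cs).
Proof.
rewrite -(alt_len_filter (P := is_bot k)) ?is_bot_bot //.
rewrite filter_insert0; last by move=> x /mapP[y _ ->]; rewrite is_bot_top.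
rewrite alt_len_filter ?is_bot_bot // flatten_bot_copy (@alt_len_map predT) //.
by move=> x y _ _ /enc_bot_inj.
Qed.

(** An inserted symbol stands last in its block, so the earlier symbol [b] comes from a copy of
    [bot]. If [a] comes from the same copy, nestedness is inherited. Otherwise [a] is the inserted
    symbol: within the copy it occurs only in this block, and [b] does not occur outside the copy,
    so the surroundings read a* b* [b a] b* a*. *)
Lemma shuffle_nested bot sub : nested bot -> all uniq sub -> nested (shuffle bot 0 sub).
Proof.
move=> nb us pre B post a b E ab.
have {E} [k [s1 [s2 [X [p' [q' [Xs -> -> E [h1 h2 _]]]]]]]] := shuffle_mid E.
have {E} [p [c [q [xs1 [o [xs2 [ec exs so [-> -> ->]]]]]]]] := insert_mid E.
have [p0 [c0 [q0 [eb -> -> ->]]]] : exists p0 c0 q0, [/\ bot = p0 ++ c0 :: q0,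
    p = bot_copy k p0, c = map (enc_bot k) c0 & q = bot_copy k q0].
  exists (take (size p) bot), (nth [::] bot (size p)), (drop (size p).+1 bot).
  have lt : size p < size bot.
    by rewrite -(size_map (map (enc_bot k)) bot) -/(bot_copy k bot) ec size_cat /=; lia.
  split; first by rewrite -drop_nth // cat_take_drop.
  - by rewrite /bot_copy map_take -/(bot_copy k bot) ec take_size_cat.
  - by rewrite -(nth_map _ [::]) // -/(bot_copy k bot) ec nth_cat ltnn subnn.
  - by rewrite /bot_copy map_drop -/(bot_copy k bot) ec -cat_rcons drop_size_cat // size_rcons.
have [Y1 e1] : exists Y1, xs1 = map enc_top Y1.
  by exists (take (size xs1) X); rewrite map_take exs take_size_cat.
have [Y2 e2] : exists Y2, xs2 = map enc_top Y2.
  exists (drop (size (xs1 ++ o)) X); rewrite map_drop exs catA drop_size_cat //.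
have ux : uniq (xs1 ++ o ++ xs2) by rewrite -exs (map_inj_uniq enc_top_inj) (allP us).
have otop z : z \in o -> exists y, z = enc_top y.
  move=> zo; have : z \in map enc_top X by rewrite exs !mem_cat zo orbT.
  by case/mapP => y _ ->; exists y.
rewrite !flatten_cat => hB; have [bB aB] := alt_len_gt1 hB.
have binc : b \in map (enc_bot k) c0.
  move: bB; rewrite mem_cat => /orP[//|bo]; exfalso.
  have [z bz] := otop _ bo.
  have bc : b \notin map (enc_bot k) c0.
    by rewrite bz; apply/mapP => -[y _ /enc_top_bot].
  have ao : a \notin o.
    case: o so bo {exs ux otop hB aB} => [|o1 [|]] // _; rewrite !inE => /eqP <-.
    by rewrite (negPf ab).
  by move: hB; rewrite alt_len_cat (alt_len_notin _ bc) /= add0n; have := alt_len_notin2 b ao; lia.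
case/mapP: (binc) => b0 b0c eb0; subst b.
have [ac|anc] := boolP (a \in map (enc_bot k) c0).
  case/mapP: ac => a0 a0c ea0; subst a xs1 xs2.
  have nbo y : enc_bot k y \notin o by apply/negP => /otop[z /esym/enc_top_bot].
  have hc : 1 < alt_len b0 a0 c0.
    move: hB; rewrite alt_len_cat (alt_len_notin _ (nbo b0)) (alt_len_notin _ (nbo a0)) if_same addn0.
    by rewrite (@alt_len_map predT) // => x y _ _ /enc_bot_inj.
  have ab0 : a0 != b0 by apply: contraNneq ab => ->.
  have [n1 n2] := nb _ _ _ _ _ eb ab0 hc.
  by rewrite !alt_len_cat !(alt_len_notin _ (h1 _)) /= !(alt_len_notin _ (h2 _)) !alt_len_insert_bot if_same addn0.
have ao : a \in o by move: aB; rewrite mem_cat (negPf anc).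
have [a0 ea0] := otop _ ao; subst a.
move: ux; rewrite cat_uniq => /and3P[_ /hasPn d1]; rewrite cat_uniq => /and3P[_ /hasPn d2 _].
have a1 : enc_top a0 \notin xs1 by apply: d1; rewrite mem_cat ao.
have a2 : enc_top a0 \notin xs2 by apply/negP => /d2; rewrite /= ao.
have nota xs cs : enc_top a0 \notin xs -> enc_top a0 \notin flatten (insert xs (bot_copy k cs)).
  move=> nx; apply/negP => /mem_insert[ax|]; first by rewrite ax in nx.
  by rewrite flatten_bot_copy => /mapP[y _ /enc_top_bot].
rewrite !alt_len_cat (alt_len_notin _ (h1 _)) /= (alt_len_notin _ (nota _ _ a2)) /= !add0n.
by rewrite !alt_len_notin2 // nota.
Qed.

(** Two inserted symbols alternate as in [sub], two symbols of one copy as in [bot], and symbols of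
    different copies lie in disjoint stretches. The mixed pairs are the reason for [4 < M]. *)
Lemma shuffle_alt M bot sub : 4 < M -> alt_le M (flatten bot) -> alt_le M (flatten sub) ->
  all uniq sub -> all (fun B => size B <= size bot) sub ->
  alt_le M (flatten (shuffle bot 0 sub)).
Proof.
move=> M5 Ab As us ss a b ab; set S := flatten _.
have [aS|/alt_len_notin->//] := boolP (a \in S).
have [bS|/alt_len_notin2-/(_ a)] := boolP (b \in S); last by lia.
have split k y : enc_bot k y \in S -> exists s1 s2 X, [/\ X \in sub,
    S = s1 ++ flatten (insert (map enc_top X) (bot_copy k bot)) ++ s2,
    forall y, enc_bot k y \notin s1 & forall y, enc_bot k y \notin s2].
  case/flattenP => B BS yB; have [pre [post E]] : exists pre post,
      shuffle bot 0 sub = pre ++ B :: post.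
    exists (take (index B (shuffle bot 0 sub)) (shuffle bot 0 sub)).
    exists (drop (index B (shuffle bot 0 sub)).+1 (shuffle bot 0 sub)).
    by rewrite -[B in _ ++ B :: _](nth_index [::] BS) -drop_nth ?index_mem // cat_take_drop.
  have [k' [s1 [s2 [X [p [q [Xs e1 e2 e3 [h1 h2 _]]]]]]]] := shuffle_mid E.
  have : enc_bot k y \in flatten (insert (map enc_top X) (bot_copy k' bot)).
    by rewrite e3 flatten_cat /= !mem_cat yB orbT.
  have -> : S = flatten s1 ++ flatten (insert (map enc_top X) (bot_copy k' bot)) ++ flatten s2.
    by rewrite /S E e1 e2 e3 !flatten_cat /= !flatten_cat -!catA.
  case/mem_insert; first by case/mapP => ? _ /esym/enc_top_bot.
  rewrite flatten_bot_copy => /mapP[y' _ /enc_bot_inj2[-> _]].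
  by exists (flatten s1), (flatten s2), X; split.
(* With a the inserted symbol and b the one from the copy, the pair reads at most a* b* a b* a*: a
   block of [sub] has no repetition, so a enters the copy at most once. *)
have ctop x k y s1 s2 X : X \in sub -> enc_bot k y \notin s1 -> enc_bot k y \notin s2 ->
    let s := s1 ++ flatten (insert (map enc_top X) (bot_copy k bot)) ++ s2 in
    alt_len (enc_top x) (enc_bot k y) s <= 5 /\ alt_len (enc_bot k y) (enc_top x) s <= 5.
  move=> Xs n1 n2 /=; set mid := flatten _.
  have cm : count_mem (enc_top x) mid <= 1.
    apply: leq_trans (count_insert_le _ _ _) _; rewrite count_uniq_mem ?(map_inj_uniq enc_top_inj) ?(allP us) //.
    rewrite (_ : count _ (flatten _) = 0) ?addn0 ?leq_b1 //; apply/count_memPn.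
    by rewrite flatten_bot_copy; apply/mapP => -[? _ /enc_top_bot].
  have h1 := alt_len_count (enc_top x) (enc_bot k y) mid.
  have h2 := alt_len_swap (enc_bot k y) (enc_top x) mid.
  have h3 := alt_len_notin2 (enc_top x) n1; have h4 := alt_len_notin2 (enc_top x) n2.
  rewrite !alt_len_cat (alt_len_notin _ n1) (alt_len_notin _ n2) /= add0n.
  by split; repeat case: ifP => _; lia.
have [[x xs ex]|[k [y [_ yb ea]]]] := mem_shuffle aS.
  have [[x' xs' ex']|[k [y [_ yb eb]]]] := mem_shuffle bS.
    subst a b; rewrite -(alt_len_filter (P := is_top)) ?is_top_top // filter_top_shuffle //.
    rewrite (@alt_len_map predT) //; last by move=> ? ? _ _ /enc_top_inj.
    by apply: As; apply: contraNneq ab => ->.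
  subst a b; have [s1 [s2 [X [Xs -> n1 n2]]]] := split _ _ bS.
  by have [h _] := ctop x k y _ _ _ Xs (n1 y) (n2 y); apply: leq_trans h _.
have [[x xs ex]|[k' [y' [_ yb' eb]]]] := mem_shuffle bS.
  subst a b; have [s1 [s2 [X [Xs -> n1 n2]]]] := split _ _ aS.
  by have [_ h] := ctop x k y _ _ _ Xs (n1 y) (n2 y); apply: leq_trans h _.
subst a b; have [s1 [s2 [X [Xs -> n1 n2]]]] := split _ _ aS.
have [kk|kk] := eqVneq k k'.
  subst k'; rewrite alt_len_mid // alt_len_insert_bot; apply: Ab.
  by apply: contraNneq ab => ->.
have nb : enc_bot k' y' \notin flatten (insert (map enc_top X) (bot_copy k bot)).
  apply/negP => /mem_insert[/mapP[? _ /esym/enc_top_bot //]|].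
  by rewrite flatten_bot_copy => /mapP[? _ /enc_bot_inj2[/esym/eqP]]; rewrite (negPf kk).
have h := alt_len_notin2 (enc_bot k y) nb.
rewrite !alt_len_cat !(alt_len_notin _ (n1 _)) !(alt_len_notin _ (n2 _)) (alt_len_notin _ nb) /= add0n.
have h1 := alt_len_swap (enc_bot k y) (enc_bot k' y') s2.
have h2 := alt_len_notin2 (enc_bot k' y') (n2 y).
by case: ifP => _; lia.
Qed.

(** The alphabets of [sub] and of the copies are disjoint, so an average multiplicity of at least
    [c] in each of them passes to the whole. *)
Lemma good_shuffle c M j sub bot : 4 < M -> good c M j bot ->
  all uniq sub -> all (fun B => size B == size bot) sub -> alt_le M (flatten sub) ->
  c * nsym (flatten sub) <= size (flatten sub) ->
  good c M j.+1 (shuffle bot 0 sub).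
Proof.
move=> M5 [ub sb nb Ab cb] us ss As cs.
have ss' : all (fun B => size B <= size bot) sub by apply: sub_all ss => B /eqP->.
have [h1 h2] := shuffle_all_size 0 ub sb ss.
split=> //; [exact: shuffle_nested | exact: shuffle_alt |].
rewrite size_flatten_shuffle //; apply: leq_trans (leq_mul (leqnn c) (nsym_shuffle bot sub)) _.
by rewrite mulnDr mulnCA leq_add // leq_mul.
Qed.

(** * Blockwise substitution *)

(** [G] also receives everything that follows the block, so that it can recognise last occurrences;
    [t] stands for what comes after [bs]. *)
Fixpoint replace (G : seq nat -> seq nat -> seq (seq nat)) (t : seq nat)
    (bs : seq (seq nat)) : seq (seq nat) :=
  if bs is B :: bs' then G (flatten bs' ++ t) B ++ replace G t bs' else [::].

Lemma replace_cat G t p q :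
  replace G t (p ++ q) = replace G (flatten q ++ t) p ++ replace G t q.
Proof. by elim: p => //= B p ->; rewrite flatten_cat !catA. Qed.

(** Each block contributes at most one of the two symbols, and its replacement can only repeat or
    delete that one. *)
Lemma replace_unshared G t bs a b :
  (forall t B, {subset flatten (G t B) <= B}) ->
  all (fun B => ~~ ((a \in B) && (b \in B))) bs ->
  alt_len a b (flatten (replace G t bs)) <= alt_len a b (flatten bs).
Proof.
move=> G_sub; elim: bs a b => //= B bs IH a b /andP[hB hs].
have h1 := IH a b hs.
have {IH} h2 : alt_len b a (flatten (replace G t bs)) <= alt_len b a (flatten bs).
  by apply: IH; apply: sub_all hs => C; rewrite andbC.
rewrite flatten_cat; set g := flatten (G _ B).
have h3 := alt_len_swap a b (flatten bs).
have gs x : x \notin B -> x \notin g by apply: contra => /G_sub.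
rewrite !alt_len_cat; have [aB|aB] := boolP (a \in B); last first.
  by rewrite !(alt_len_notin _ aB) !(alt_len_notin _ (gs _ aB)).
rewrite aB /= in hB; rewrite (alt_len_only aB hB) /=.
have := alt_len_notin2 a (gs _ hB); case: (alt_len a b g) => [|[|//]] _ /=; lia.
Qed.

(** [B] is the only shared block, so the sequence reads a* b* g b* a* with [g] the replacement of
    [B]. The bounds 3 and 2 are those of b a a b and give length at most 5. In the second case
    nothing follows [g]: at most 5 terms can follow an initial a, and at most 4 an initial a, b,
    hence length at most 6. *)
Lemma replace_shared G M t pre B post a b :
  (forall t B, {subset flatten (G t B) <= B}) -> nested (pre ++ B :: post) ->
  a != b -> 1 < alt_len b a B -> 4 < M ->
  (let g := flatten (G (flatten post ++ t) B) in
   (alt_len b a g <= 3 /\ alt_len a b g <= 2) \/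
   [/\ 5 < M, a \notin flatten post, b \notin flatten post, alt_len b a g <= 5 & alt_len a b g <= 4]) ->
  let s := flatten (replace G t (pre ++ B :: post)) in
  alt_len a b s <= M /\ alt_len b a s <= M.
Proof.
move=> G_sub nst ab hB M5 H; have [aB bB] : a \in B /\ b \in B by have [] := alt_len_gt1 hB.
have [n1 n2] := nst _ _ _ _ _ erefl ab hB.
have ba : b != a by rewrite eq_sym.
(* A block of [pre] in which [b] precedes [a] contradicts nestedness at [B]; one with the opposite
   order contradicts nestedness at that block. For [post] the two orders exchange their roles. *)
have upre : all (fun C => ~~ ((a \in C) && (b \in C))) pre.
  apply/allP => C Cpre; apply/negP => /andP[aC bC].
  have [p [q E]] : exists p q, pre = p ++ C :: q.
    by case/path.splitPr: Cpre => p q; exists p, q.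
  subst pre; have [h|h] := alt_len_total ab aC bC.
    have := nst p C (q ++ B :: post) b a; rewrite -catA => /(_ erefl ba h) [_].
    rewrite flatten_cat /=; apply/negP; rewrite -ltnNge.
    apply: leq_trans hB _; apply: alt_len_subseq; rewrite -[B in subseq B _]cat0s.
    by apply: cat_subseq; rewrite ?sub0seq ?prefix_subseq.
  move: n1; apply/negP; rewrite -ltnNge; apply: leq_trans h _; apply: alt_len_subseq.
  rewrite flatten_cat -[C in subseq C _]cat0s.
  by apply: cat_subseq; rewrite ?sub0seq ?prefix_subseq.
have upost : all (fun C => ~~ ((a \in C) && (b \in C))) post.
  apply/allP => C Cpost; apply/negP => /andP[aC bC].
  have [p [q E]] : exists p q, post = p ++ C :: q.
    by case/path.splitPr: Cpost => p q; exists p, q.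
  subst post; have [h|h] := alt_len_total ab aC bC.
    move: n2; apply/negP; rewrite -ltnNge; apply: leq_trans h _; apply: alt_len_subseq.
    rewrite flatten_cat -[C in subseq C _]cat0s.
    by apply: cat_subseq; rewrite ?sub0seq ?prefix_subseq.
  have := nst (pre ++ B :: p) C q a b; rewrite -catA => /(_ erefl ab h) [+ _].
  rewrite flatten_cat /=; apply/negP; rewrite -ltnNge.
  apply: leq_trans hB _; apply: alt_len_subseq; rewrite -[B in subseq B _]cat0s.
  by apply: cat_subseq; rewrite ?sub0seq ?prefix_subseq.
have u' bs : all (fun C => ~~ ((a \in C) && (b \in C))) bs ->
    all (fun C => ~~ ((b \in C) && (a \in C))) bs.
  by apply: sub_all => C; rewrite andbC.
rewrite replace_cat /= !flatten_cat.
set r := flatten (replace _ _ pre); set g := flatten (G _ B) in H *.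
set r' := flatten (replace _ _ post).
have r1 : alt_len b a r <= 1 by apply: leq_trans n1; apply/(replace_unshared _ G_sub)/u'.
have r'1 : alt_len a b r' <= 1 by apply: leq_trans n2; apply/(replace_unshared _ G_sub).
have r2 := alt_len_swap a b r; have r'2 := alt_len_swap b a r'.
have g2 := alt_len_swap a b g; have g3 := alt_len_swap b a g.
rewrite !alt_len_cat; case: H => [[y' y]|[M6 apost bpost y' y]].
  split.
    move: (alt_len a b r) r1 r2 => [|[|[|n]]] /= r1 r2; try lia.
    - by case: ifP => o; move: (alt_len a b g) o y => [|[|[|?]]]; lia.
    - by case: ifP => o; move: (alt_len b a g) o y' => [|[|[|[|?]]]]; lia.
    - by case: ifP => o; move: (alt_len a b g) o y => [|[|[|?]]]; lia.
  move: (alt_len b a r) r1 => [|[|n]] //= _.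
  - by case: ifP => o; move: (alt_len b a g) o y' => [|[|[|[|?]]]]; lia.
  - by case: ifP => o; move: (alt_len a b g) o y => [|[|[|?]]]; lia.
have z1 : alt_len a b r' = 0.
  by apply/eqP; rewrite -leqn0 -(alt_len_notin b apost); apply/(replace_unshared _ G_sub).
have z2 : alt_len b a r' = 0.
  by apply/eqP; rewrite -leqn0 -(alt_len_notin a bpost); apply/(replace_unshared _ G_sub)/u'.
rewrite z1 z2 !if_same !addn0.
split; last by case: ifP => _; lia.
by case: ifP => o; move: (alt_len a b r) o r2 => [|[|[|?]]]; lia.
Qed.

Lemma replace_alt G M t bs :
  (forall t B, {subset flatten (G t B) <= B}) -> nested bs -> 4 < M -> alt_le M (flatten bs) ->
  (forall t B a b, B \in bs -> a != b -> 1 < alt_len b a B ->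
   let g := flatten (G t B) in
   (alt_len b a g <= 3 /\ alt_len a b g <= 2) \/
   [/\ 5 < M, a \notin t, b \notin t, alt_len b a g <= 5 & alt_len a b g <= 4]) ->
  alt_le M (flatten (replace G t bs)).
Proof.
move=> G_sub nst M5 Am H a b ab; pose shared := fun B : seq nat => (a \in B) && (b \in B).
have [/hasP[B Bbs /andP[aB bB]]|/hasPn un] := boolP (has shared bs); last first.
  apply: leq_trans (Am a b ab); apply: replace_unshared => //; apply/allP => C /un //.
have [p [q E]] : exists p q, bs = p ++ B :: q.
  by case/path.splitPr: Bbs => p q; exists p, q.
subst bs; have ba : b != a by rewrite eq_sym.
have F x y : x != y -> 1 < alt_len y x B -> let g := flatten (G (flatten q ++ t) B) in
   (alt_len y x g <= 3 /\ alt_len x y g <= 2) \/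
   [/\ 5 < M, x \notin flatten q, y \notin flatten q, alt_len y x g <= 5 & alt_len x y g <= 4].
  move=> xy h; case: (H (flatten q ++ t) B x y Bbs xy h) => [|[h1 + + h4 h5]]; first by left.
  by rewrite !mem_cat !negb_or => /andP[? _] /andP[? _]; right.
have [h|h] := alt_len_total ab aB bB.
  by have [] := replace_shared (t := t) G_sub nst ba h M5 (F _ _ ba h).
by have [] := replace_shared (t := t) G_sub nst ab h M5 (F _ _ ab h).
Qed.

(** * Doubling of blocks and the step in order 4 *)

Definition mirror (_ B : seq nat) : seq (seq nat) := [:: B; rev B].

Lemma alt_len_mirror a b B : a != b -> uniq B -> 1 < alt_len b a B ->
  alt_len b a (B ++ rev B) = 3 /\ alt_len a b (B ++ rev B) = 2.
Proof.
move=> ab uB hB; have f := alt_len_uniq_filter ab uB hB.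
have e : [seq x <- B ++ rev B | pred2 a b x] = [:: b; a; a; b].
  by rewrite filter_cat filter_rev f.
have ba : b != a by rewrite eq_sym.
have Pa : pred2 a b a by rewrite /= eqxx.
have Pb : pred2 a b b by rewrite /= eqxx orbT.
rewrite -(alt_len_filter (B ++ rev B) Pb Pa) -(alt_len_filter (B ++ rev B) Pa Pb) e /=.
by rewrite !eqxx ?(negPf ab) ?(negPf ba) ?eqxx ?(negPf ab) ?(negPf ba) /= ?eqxx.
Qed.

Lemma flatten_mirror_perm t bs : perm_eq (flatten (replace mirror t bs)) (flatten bs ++ flatten bs).
Proof.
elim: bs => //= B bs IH; apply/permP => P; rewrite !count_cat count_rev.
by have /permP/(_ P) := IH; rewrite !count_cat => ->; lia.
Qed.

Lemma nsym_sub s t : {subset s <= t} -> nsym s <= nsym t.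
Proof.
move=> st; apply: uniq_leq_size; first exact: undup_uniq.
by move=> x; rewrite !mem_undup => /st.
Qed.

Lemma size_replace_mirror t bs : size (replace mirror t bs) = 2 * size bs.
Proof. by elim: bs => //= B bs ->; rewrite mulnS. Qed.

Lemma replace_mirror_all w t bs : all uniq bs -> all (fun B => size B == w) bs ->
  all uniq (replace mirror t bs) /\ all (fun B => size B == w) (replace mirror t bs).
Proof.
elim: bs => //= B bs IH /andP[u us] /andP[s ss]; have [-> ->] := IH us ss.
by rewrite u rev_uniq u size_rev s.
Qed.

(** Doubling the blocks of [top] doubles every multiplicity and keeps the alphabet. The block length
    of [top] is the number of blocks of [bot], as the shuffle requires. *)
Lemma good_mirror c j top bot : good c 5 (size bot) top -> good (2 * c) 5 j bot ->
  good (2 * c) 5 j.+1 (shuffle bot 0 (replace mirror [::] top)).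
Proof.
move=> [ut st nt At ct] gb.
have [us ss] := replace_mirror_all [::] ut st.
have pe := flatten_mirror_perm [::] top.
apply: good_shuffle => //.
  apply: replace_alt => //.
    by move=> t B x; rewrite /= cats0 mem_cat mem_rev orbb.
  move=> t B a b Bt ab hB; rewrite /= cats0; left.
  by have [-> ->] := alt_len_mirror ab (allP ut _ Bt) hB.
rewrite (perm_size pe) size_cat.
have : nsym (flatten (replace mirror [::] top)) <= nsym (flatten top).
  by apply: nsym_sub => x; rewrite (perm_mem pe) mem_cat orbb.
by move=> h; rewrite -mulnA addnn -mul2n leq_mul2l /=; apply: leq_trans ct; rewrite leq_mul.
Qed.

(** * Substitution for last occurrences *)

(** Only full groups are kept; the remainder of the division is deleted. *)
Definition chunks (w : nat) (s : seq nat) : seq (seq nat) :=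
  reshape (nseq (size s %/ w) w) s.

Lemma size_chunks w s : size (chunks w s) = size s %/ w.
Proof. by rewrite size_reshape size_nseq. Qed.

Lemma chunks_size w s : all (fun c => size c == w) (chunks w s).
Proof.
have := @reshapeKl _ (nseq (size s %/ w) w) s.
rewrite sumn_nseq mulnC leq_divM -/(chunks w s) => /(_ isT) e.
have : all (pred1 w) (shape (chunks w s)) by rewrite e all_nseq /= eqxx orbT.
by rewrite all_map.
Qed.

Lemma flatten_chunks_subseq w s : subseq (flatten (chunks w s)) s.
Proof.
rewrite /chunks; move: (nseq _ _) => sh; elim: sh s => [|n sh IH] s /=; first exact: sub0seq.
by rewrite -[X in subseq _ X](cat_take_drop n s) cat_subseq.
Qed.

Lemma chunks_all_uniq w s : uniq s -> all uniq (chunks w s).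
Proof.
move=> us; have := subseq_uniq (flatten_chunks_subseq w s) us.
by elim: (chunks w s) => //= c cs IH; rewrite cat_uniq => /and3P[-> _ /IH].
Qed.

Lemma chunk_sub w s c : c \in chunks w s -> {subset c <= s}.
Proof.
move=> cs x xc; apply: (mem_subseq (flatten_chunks_subseq w s)).
by apply/flattenP; exists c.
Qed.

(** Symbols from different groups stay in the order b, a of [s], whatever is substituted. Symbols of
    one group occur in no other, so only the image of that group counts. *)
Lemma chunk_cases (h : seq nat -> seq (seq nat)) cs s a b :
  subseq (flatten cs) s -> uniq s -> a != b -> 1 < alt_len b a s ->
  {in cs, forall c, {subset flatten (h c) <= c}} ->
  let X := flatten (flatten (map h cs)) in
  (alt_len b a X <= 2 /\ alt_len a b X <= 1) \/
  (exists c, [/\ c \in cs, 1 < alt_len b a c, alt_len b a X = alt_len b a (flatten (h c))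
     & alt_len a b X = alt_len a b (flatten (h c))]).
Proof.
move=> css us ab hs hsub X.
have ba : b != a by rewrite eq_sym.
have s1 : alt_len a b s = 1.
  have Pa : pred2 a b a by rewrite /= eqxx.
  have Pb : pred2 a b b by rewrite /= eqxx orbT.
  by rewrite -(alt_len_filter s Pa Pb) (alt_len_uniq_filter ab us hs) /= eqxx (negPf ba).
have s2 : alt_len b a s <= 2.
  by apply: leq_trans (alt_len_count _ _ _) _; rewrite count_uniq_mem //; case: (_ \in _).
have ucs := subseq_uniq css us.
have [/hasP[c ccs /andP[ac bc]]|/hasPn un] :=
  boolP (has (fun c : seq nat => (a \in c) && (b \in c)) cs).
  right; exists c.
  have [p [q E]] : exists p q, cs = p ++ c :: q.
    by case/path.splitPr: ccs => p q; exists p, q.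
  have hc : 1 < alt_len b a c.
    case: (alt_len_total ab ac bc) => // hc; have : alt_len a b c <= alt_len a b s.
      apply: alt_len_subseq; apply: subseq_trans css; rewrite E flatten_cat -[c in subseq c _]cat0s.
      by apply: cat_subseq; rewrite ?sub0seq ?prefix_subseq.
    lia.
  have hsub' cs' : {subset cs' <= cs} ->
      {subset flatten (flatten (map h cs')) <= flatten cs'}.
    move=> scs x /flattenP[u /flattenP[v /mapP[c' c'cs ->] uv] xu].
    apply/flattenP; exists c' => //; apply: (hsub _ (scs _ c'cs)).
    by apply/flattenP; exists u.
  have hp : {subset flatten (flatten (map h p)) <= flatten p}.
    by apply: hsub' => x xp; rewrite E mem_cat xp.
  have hq : {subset flatten (flatten (map h q)) <= flatten q}.
    by apply: hsub' => x xp; rewrite E mem_cat inE xp !orbT.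
  have out x : x \in c -> (x \notin flatten p) * (x \notin flatten q).
    move=> xc; move: ucs; rewrite E flatten_cat /= cat_uniq => /and3P[_ /hasPn d1].
    rewrite cat_uniq => /and3P[_ /hasPn d2 _]; split; last first.
      by apply/negP => /d2; rewrite /= xc.
    by apply: d1; rewrite mem_cat xc.
  rewrite /X E map_cat /= !flatten_cat.
  split=> //; first by rewrite mem_cat mem_head orbT.
    by rewrite alt_len_mid //; apply/negP; (move=> /hp || move=> /hq); apply/negP; rewrite out.
  by rewrite alt_len_mid //; apply/negP; (move=> /hp || move=> /hq); apply/negP; rewrite out.
(* The guard makes the inclusion hold for every list, as [replace_unshared] demands; the members of
   [cs] pass it by [hsub]. *)
left; pose G := fun _ c : seq nat => if all (mem c) (flatten (h c)) then h c else [::].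
have Gsub t c : {subset flatten (G t c) <= c}.
  by rewrite /G; case: ifP => // /allP h' x /h'.
have XG : X = flatten (replace G [::] cs).
  rewrite /X; congr flatten; elim: cs hsub {css ucs un X} => //= c cs IH hsub.
  rewrite IH /G; last by move=> c' c'cs; apply: hsub; rewrite inE c'cs orbT.
  by rewrite (introT allP (hsub c (mem_head _ _))).
have u1 : all (fun c => ~~ ((a \in c) && (b \in c))) cs by apply/allP.
have u2 : all (fun c => ~~ ((b \in c) && (a \in c))) cs.
  by apply: sub_all u1 => c; rewrite andbC.
rewrite XG; split.
  by apply: leq_trans (replace_unshared _ Gsub u2) _; apply: leq_trans (alt_len_subseq _ _ css) _.
apply: leq_trans (replace_unshared _ Gsub u1) _; apply: leq_trans (alt_len_subseq _ _ css) _.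
by rewrite s1.
Qed.

(* The symbols of [U], listed by last occurrence, are renamed to those of [c] in reverse order. *)
Definition relabel (U : seq (seq nat)) (c : seq nat) : seq (seq nat) :=
  map (map (fun x => nth 0 (rev c) (index x (undup (flatten U))))) U.

Lemma flatten_relabel U c : flatten (relabel U c) =
  map (fun x => nth 0 (rev c) (index x (undup (flatten U)))) (flatten U).
Proof. by rewrite /relabel map_flatten. Qed.

Lemma relabel_sub U c : size c = nsym (flatten U) -> {subset flatten (relabel U c) <= c}.
Proof.
move=> sc x; rewrite flatten_relabel => /mapP[y yU ->].
by rewrite -(mem_rev c) mem_nth // size_rev sc index_mem mem_undup.
Qed.

Lemma relabel_inj U c : size c = nsym (flatten U) -> uniq c ->
  {in flatten U &, injective (fun x => nth 0 (rev c) (index x (undup (flatten U))))}.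
Proof.
move=> sc uc x y xU yU /eqP; have o z : z \in flatten U ->
   index z (undup (flatten U)) < size (rev c).
  by move=> zU; rewrite size_rev sc index_mem mem_undup.
rewrite nth_uniq ?o ?rev_uniq // => /eqP.
by apply: index_inj; rewrite ?mem_undup // inE mem_undup.
Qed.

Lemma relabel_all_uniq U c : size c = nsym (flatten U) -> uniq c ->
  all uniq U -> all uniq (relabel U c).
Proof.
move=> sc uc uU; rewrite /relabel all_map; apply/allP => u uin /=.
rewrite map_inj_in_uniq ?(allP uU) // => x y xu yu; apply: relabel_inj => //.
  by apply/flattenP; exists u.
by apply/flattenP; exists u.
Qed.

Lemma relabel_size w U c : all (fun u => size u == w) U ->
  all (fun u => size u == w) (relabel U c).
Proof. by rewrite /relabel all_map; apply: sub_all => u /=; rewrite size_map. Qed.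

(** The reversal makes [b], the earlier symbol of [c], the later one to disappear. An alternation
    starting with [a] then has even greedy length, which lowers the bound 5 to 4. *)
Lemma relabel_al U c a b : size c = nsym (flatten U) -> uniq c ->
  alt_le 5 (flatten U) -> a != b -> 1 < alt_len b a c ->
  alt_len b a (flatten (relabel U c)) <= 5 /\ alt_len a b (flatten (relabel U c)) <= 4.
Proof.
move=> sc uc A5 ab hc; have [bc ac] := alt_len_gt1 hc.
set o := undup (flatten U); pose f x := nth 0 (rev c) (index x o).
have so : size o = size (rev c) by rewrite size_rev sc.
have uo : uniq o by exact: undup_uniq.
have pre x : x \in c -> exists2 y, y \in o & x = f y /\ index y o = index x (rev c).
  move=> xc; have ix : index x (rev c) < size o by rewrite so index_mem mem_rev.
  exists (nth 0 o (index x (rev c))); first exact: mem_nth.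
  by rewrite /f index_uniq // nth_index // mem_rev.
have [a0 a0o [ea ia]] := pre a ac; have [b0 b0o [eb ib]] := pre b bc.
have ab0 : a0 != b0 by apply: contraNneq ab => e; rewrite ea eb e.
have ba0 : b0 != a0 by rewrite eq_sym.
have lt : index a0 o < index b0 o.
  rewrite ia ib; apply: alt_len_index; rewrite ?rev_uniq //.
  have Pa : pred2 a b a by rewrite /= eqxx.
  have Pb : pred2 a b b by rewrite /= eqxx orbT.
  rewrite -(alt_len_filter (rev c) Pa Pb) filter_rev (alt_len_uniq_filter ab uc hc) /=.
  by rewrite eqxx eqxx.
have b0U : b0 \in flatten U by rewrite -mem_undup.
have a0U : a0 \in flatten U by rewrite -mem_undup.
have [ev _] := alt_len_undup_odd ab0 b0U lt.
rewrite flatten_relabel -/o ea eb.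
have inj := relabel_inj sc uc.
have E x y : x \in flatten U -> y \in flatten U ->
   alt_len (f x) (f y) (map f (flatten U)) = alt_len x y (flatten U).
  by move=> xU yU; rewrite (@alt_len_map (mem (flatten U))).
rewrite -/f !E //; split; first exact: A5.
by have := A5 _ _ ab0; move: ev; case: (alt_len a0 b0 _) => [|[|[|[|[|[|]]]]]].
Qed.

(* [t] is the part of the sequence that follows the block [B], so the first group consists of the last occurrences. *)
Definition split_block (U : seq (seq nat)) (w : nat) (t B : seq nat) : seq (seq nat) :=
  flatten (map (relabel U) (chunks (nsym (flatten U)) [seq x <- B | x \notin t])) ++
  flatten (map (mirror [::]) (chunks w [seq x <- B | x \in t])).

Lemma mirror_sub t c : {subset flatten (mirror t c) <= c}.
Proof. by move=> x; rewrite /= cats0 mem_cat mem_rev orbb. Qed.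

Lemma chunk_map_sub (h : seq nat -> seq (seq nat)) w s :
  (forall c, size c = w -> {subset flatten (h c) <= c}) ->
  {subset flatten (flatten (map h (chunks w s))) <= s}.
Proof.
move=> hsub x /flattenP[u /flattenP[v /mapP[c cc ->] uv] xu].
apply: (chunk_sub cc); apply: hsub; first by apply/eqP; exact: (allP (chunks_size w s)).
by apply/flattenP; exists u.
Qed.

Lemma split_block_sub U w t B : {subset flatten (split_block U w t B) <= B}.
Proof.
move=> x; rewrite flatten_cat mem_cat => /orP[] /chunk_map_sub.
  by move=> /(_ (@relabel_sub U)); rewrite mem_filter => /andP[].
by move=> /(_ (fun c _ => @mirror_sub _ c)); rewrite mem_filter => /andP[].
Qed.

(** If both symbols recur in [t], they are doubled or fall into different groups. If one recurs,
    they lie in separate stretches. If neither recurs, they share a copy of [U], which is the second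
    alternative, or lie in different groups. *)
Lemma split_block_al U w t B a b : alt_le 5 (flatten U) -> uniq B ->
  a != b -> 1 < alt_len b a B ->
  let g := flatten (split_block U w t B) in
  (alt_len b a g <= 3 /\ alt_len a b g <= 2) \/
  [/\ 5 < 6, a \notin t, b \notin t, alt_len b a g <= 5 & alt_len a b g <= 4].
Proof.
move=> A5 uB ab hB; rewrite /split_block flatten_cat /=.
set F := filter _ B; set M := filter _ B.
set XF := flatten (flatten (map _ _)); set XM := flatten (flatten (map _ _)).
have Fs : {subset XF <= F} by apply: chunk_map_sub => c; exact: relabel_sub.
have Ms : {subset XM <= M} by apply: chunk_map_sub => c _; exact: mirror_sub.
have FN x : x \in t -> x \notin XF.
  by move=> xt; apply/negP => /Fs; rewrite mem_filter xt.
have MN x : x \notin t -> x \notin XM.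
  by move=> xt; apply/negP => /Ms; rewrite mem_filter (negPf xt).
have [bB aB] := alt_len_gt1 hB.
have [aT|aT] := boolP (a \in t); have [bT|bT] := boolP (b \in t).
- left; have hM : 1 < alt_len b a M by rewrite alt_len_filter.
  have uM : uniq M by rewrite filter_uniq.
  rewrite !alt_len_cat !(alt_len_notin _ (FN _ _)) //= !add0n.
  have [[h1 h2]|[c [cM hc -> ->]]] := chunk_cases (flatten_chunks_subseq w M) uM ab hM
      (fun c _ => @mirror_sub [::] c); first by split; [apply: leq_trans h1 _ | apply: leq_trans h2 _].
  rewrite /= cats0; have uc := allP (chunks_all_uniq w uM) _ cM.
  by have [-> ->] := alt_len_mirror ab uc hc.
- left; rewrite !alt_len_cat.
  rewrite (alt_len_notin _ (FN _ aT)) (alt_len_notin _ (MN _ bT)) /=.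
  have := alt_len_notin2 b (FN _ aT); have := alt_len_notin2 a (MN _ bT).
  by rewrite add0n; case: ifP => _; lia.
- left; rewrite !alt_len_cat.
  rewrite (alt_len_notin _ (FN _ bT)) (alt_len_notin _ (MN _ aT)) /=.
  have := alt_len_notin2 a (FN _ bT); have := alt_len_notin2 b (MN _ aT).
  by rewrite add0n; case: ifP => _; lia.
have hF : 1 < alt_len b a F by rewrite alt_len_filter.
have uF : uniq F by rewrite filter_uniq.
rewrite !alt_len_cat !(alt_len_notin _ (MN _ _)) //= !if_same !addn0.
have hs : {in chunks (nsym (flatten U)) F, forall c, {subset flatten (relabel U c) <= c}}.
  by move=> c cF; apply: relabel_sub; apply/eqP; exact: (allP (chunks_size _ F)).
have [[h1 h2]|[c [cF hc -> ->]]] := chunk_cases (flatten_chunks_subseq _ F) uF ab hF hs.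
  by left; split; [apply: leq_trans h1 _ | apply: leq_trans h2 _].
right; have uc := allP (chunks_all_uniq _ uF) _ cF.
have sc : size c = nsym (flatten U) by apply/eqP; exact: (allP (chunks_size _ F)).
by have [-> ->] := relabel_al sc uc A5 ab hc.
Qed.

Lemma split_block_all U w t (B : seq nat) : uniq B -> all uniq U -> all (fun u => size u == w) U ->
  all uniq (split_block U w t B) /\ all (fun u => size u == w) (split_block U w t B).
Proof.
move=> uB uU sU; rewrite /split_block !all_cat.
have uF := filter_uniq (fun x => x \notin t) uB.
have uM := filter_uniq (fun x => x \in t) uB.
set F := filter _ _ in uF *; set M := filter _ _ in uM *.
split; apply/andP; split; apply/allP => u /flattenP[v /mapP[c cc ->] uv].
- apply: (allP (relabel_all_uniq _ (allP (chunks_all_uniq _ uF) _ cc) uU)) uv.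
  by apply/eqP; exact: (allP (chunks_size _ F)).
- have uc := allP (chunks_all_uniq w uM) _ cc.
  by move: uv; rewrite !inE => /orP[] /eqP->; rewrite ?rev_uniq.
- exact: (allP (relabel_size _ sU)) uv.
- have sc := allP (chunks_size w M) _ cc.
  by move: uv; rewrite !inE => /orP[] /eqP->; rewrite ?size_rev.
Qed.

Lemma size_flatten_map (T : Type) (T' : eqType) (h : T' -> seq T) n cs : {in cs, forall c, size (h c) = n} ->
  size (flatten (map h cs)) = size cs * n.
Proof.
elim: cs => //= c cs IH hc; rewrite size_cat IH; last first.
  by move=> x xc; apply: hc; rewrite inE xc orbT.
by rewrite hc ?mem_head // mulSn.
Qed.

Lemma size_split_block U w t B : size (split_block U w t B) =
  size [seq x <- B | x \notin t] %/ nsym (flatten U) * size U +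
  size [seq x <- B | x \in t] %/ w * 2.
Proof.
rewrite /split_block size_cat (@size_flatten_map _ _ _ (size U)).
  by rewrite (@size_flatten_map _ _ _ 2) // !size_chunks.
by move=> c _; rewrite size_map.
Qed.

Lemma size_split_filter (t B : seq nat) :
  size [seq x <- B | x \notin t] + size [seq x <- B | x \in t] = size B.
Proof. by rewrite !size_filter addnC count_predC. Qed.

Lemma size_split_block_le U w t B : size (split_block U w t B) <= size B * (size U + 2).
Proof.
rewrite size_split_block -(size_split_filter t B).
set F := size _; set M := size _.
by rewrite mulnDl leq_add // leq_mul ?leq_div ?leq_addr ?leq_addl.
Qed.

Lemma nsym_cat_uniq (s t : seq nat) : uniq s -> nsym (s ++ t) = size [seq x <- s | x \notin t] + nsym t.
Proof. by move=> us; rewrite /nsym undup_cat undup_id // size_cat. Qed.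

(** Fewer than [nsym (flatten U)] symbols are deleted from the first group, each worth [P], and
    fewer than [w] from the second, each worth 2. *)
Lemma size_flatten_split_block P U w t (B : seq nat) : 0 < w -> 0 < nsym (flatten U) ->
  all uniq U -> all (fun u => size u == w) U -> uniq B ->
  P * nsym (flatten U) <= size (flatten U) ->
  P * size [seq x <- B | x \notin t] + 2 * size [seq x <- B | x \in t] <=
  size (flatten (split_block U w t B)) + (P * nsym (flatten U) + 2 * w).
Proof.
move=> w0 n0 uU sU uB hP; have [_ sG] := split_block_all t uB uU sU.
rewrite (size_flatten_const sG) size_split_block.
rewrite (size_flatten_const sU) in hP; set n := nsym _ in n0 hP *.
set F := size _; set M := size _.
have h1 := ltn_ceil F n0; have h2 := ltn_ceil M w0.
have h3 : P * F <= P * (F %/ n * n + n) by rewrite leq_mul2l; apply/orP; right; lia.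
have h4 : F %/ n * (P * n) <= F %/ n * (size U * w) by rewrite leq_mul2l hP orbT.
nia.
Qed.

(** Every symbol has exactly one last occurrence, so the first groups F have total size
    [nsym (flatten bs)]. With M for the second groups, P F + 2 M = (P - 2) F + 2 (F + M). *)
Lemma size_flatten_replace_split P U w (bs : seq (seq nat)) : 0 < w -> 0 < nsym (flatten U) ->
  all uniq U -> all (fun u => size u == w) U -> all uniq bs -> 1 < P ->
  P * nsym (flatten U) <= size (flatten U) ->
  (P - 2) * nsym (flatten bs) + 2 * size (flatten bs) <=
  size (flatten (replace (split_block U w) [::] bs)) +
  size bs * (P * nsym (flatten U) + 2 * w).
Proof.
move=> w0 n0 uU sU + P1 hP; elim: bs => [|B bs IH] /=; first by rewrite /nsym /= !muln0.
move=> /andP[uB ubs]; rewrite cats0 nsym_cat_uniq // flatten_cat !size_cat.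
have h := size_flatten_split_block (flatten bs) w0 n0 uU sU uB hP.
have hs := size_split_filter (flatten bs) B.
have {}IH := IH ubs; set Q := P * _ + _ in IH h *.
rewrite mulnDr -hs [_.+1 * Q]mulSn.
set F := size [seq x <- B | x \notin _] in h *; set M := size [seq x <- B | _] in h *.
have e : P * F = (P - 2) * F + 2 * F by rewrite -mulnDl subnK.
rewrite e {e} in h; clearbody Q F M; lia.
Qed.

Lemma size_replace_split j U w bs : all (fun B => size B == j) bs ->
  size (replace (split_block U w) [::] bs) <= size bs * j * (size U + 2).
Proof.
elim: bs => //= B bs IH /andP[/eqP sB sbs]; rewrite size_cat mulSn mulnDl.
by rewrite leq_add ?IH // -sB size_split_block_le.
Qed.

Lemma replace_split_all U w t (bs : seq (seq nat)) : all uniq bs -> all uniq U -> all (fun u => size u == w) U ->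
  all uniq (replace (split_block U w) t bs) /\
  all (fun u => size u == w) (replace (split_block U w) t bs).
Proof.
move=> + uU sU; elim: bs => //= B bs IH /andP[uB /IH[h1 h2]].
have [h3 h4] := split_block_all (flatten bs ++ t) uB uU sU.
by split; rewrite all_cat; apply/andP; split.
Qed.

Lemma replace_sub G t bs : (forall t B, {subset flatten (G t B) <= B}) ->
  {subset flatten (replace G t bs) <= flatten bs}.
Proof.
move=> h; elim: bs => //= B bs IH x; rewrite flatten_cat !mem_cat => /orP[/h ->//|/IH->].
by rewrite orbT.
Qed.

(** The blocks of [top] have length c Q, where Q is the loss per block. With m blocks, doubling
    minus loss gives 2 c m Q - m Q, and m Q is at least the number of symbols. So the loss costs one
    unit of multiplicity: (2 c - 1) + (P - 2) = 2 c + P - 3. *)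
Lemma good_split c P j top U bot : 0 < c -> 1 < P -> 0 < size bot -> 0 < size U ->
  good P 5 (size bot) U -> good (2 * c + P - 3) 6 j bot ->
  good c 6 (c * (P * nsym (flatten U) + 2 * size bot)) top -> 0 < size top ->
  let sub := replace (split_block U (size bot)) [::] top in
  good (2 * c + P - 3) 6 j.+1 (shuffle bot 0 sub) /\ 0 < size sub.
Proof.
move=> c0 P1 w0 U0 [uU sU _ AU cU] gb [ut st nt At ct] t0 sub.
have n0 : 0 < nsym (flatten U).
  have : 0 < size (flatten U) by rewrite (size_flatten_const sU) muln_gt0 U0.
  case E: (flatten U) => [|x s] // _; rewrite /nsym -E.
  by have : x \in undup (flatten U); [rewrite mem_undup E mem_head | case: (undup _)].
have [us ss] := replace_split_all [::] ut uU sU.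
have cnt := size_flatten_replace_split w0 n0 uU sU ut P1 cU.
have ts := size_flatten_const st.
set Q := _ + _ in st cnt ts.
have Q0 : 0 < Q by rewrite /Q; lia.
have nQ : nsym (flatten top) <= size top * Q.
  by rewrite -(leq_pmul2l c0); apply: leq_trans ct _; rewrite ts; lia.
have nsub : nsym (flatten sub) <= nsym (flatten top).
  by apply: nsym_sub; apply: replace_sub => t B; exact: split_block_sub.
have key : (2 * c + P - 3) * nsym (flatten top) <= size (flatten sub).
  rewrite ts in cnt; rewrite -/sub in cnt.
  have h : (2 * c - 1) * nsym (flatten top) <= (2 * c - 1) * (size top * Q).
    by rewrite leq_mul2l nQ orbT.
  have -> : 2 * c + P - 3 = (P - 2) + (2 * c - 1) by lia.
  have e : 2 * (size top * (c * Q)) = (2 * c - 1) * (size top * Q) + size top * Q.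
    rewrite -[X in _ + X]mul1n -mulnDl subnK; last by lia.
    by rewrite !mulnA; lia.
  rewrite mulnDl; rewrite e in cnt; lia.
split; last first.
  have T0 : 0 < size (flatten top) by rewrite ts !muln_gt0 t0 c0.
  have N0 : 0 < nsym (flatten top).
    case E: (flatten top) T0 => [|x s] // _; rewrite /nsym -E.
    by have : x \in undup (flatten top); [rewrite mem_undup E mem_head | case: (undup _)].
  have : 0 < size (flatten sub) by apply: leq_trans key; rewrite muln_gt0 N0; lia.
  by rewrite /sub; case: (replace _ _ _).
apply: good_shuffle => //.
  apply: replace_alt => //; first by move=> t B; exact: split_block_sub.
  by move=> t B a b Bt ab hB; apply: split_block_al => //; exact: (allP ut).
by apply: leq_trans key; rewrite leq_mul.
Qed.

(** * Growth of the number of blocks *)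

Lemma ackSS i j : 0 < j -> ack i.+2 j.+1 = ack i.+2 j * ack i.+1 (ack i.+2 j).
Proof. by case: j. Qed.

Lemma ack_exp i j : 2 ^ j <= ack i.+1 j.
Proof.
elim: i j => // i IH; elim=> [//|[//|j] IHj].
rewrite ackSS // expnSr leq_mul //; apply: leq_trans (IH _).
by rewrite -{1}(expn1 2) leq_exp2l //; apply: leq_trans IHj; rewrite expn_gt0.
Qed.

Lemma ack_gt0 i j : 0 < ack i.+1 j.
Proof. by apply: leq_trans (ack_exp i j); rewrite expn_gt0. Qed.

Lemma ack_gt i j : j < ack i.+1 j.
Proof. exact: leq_trans (ltn_expl j (ltnSn 1)) (ack_exp i j). Qed.

Lemma ack_mono i j j' : j <= j' -> ack i.+1 j <= ack i.+1 j'.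
Proof.
elim: j' => [|j' IH]; first by rewrite leqn0 => /eqP->.
rewrite leq_eqVlt => /orP[/eqP->//|]; rewrite ltnS => /IH h; apply: leq_trans h _.
case: i {IH} => [|i]; first by rewrite leq_exp2l.
by case: j' => // j'; rewrite [X in _ <= X]ackSS // leq_pmulr // ack_gt0.
Qed.

Lemma ack_2 i : ack i.+1 2 = 2 ^ i.+2.
Proof. by elim: i => // i IH; rewrite ackSS // [ack _ 1]/= IH -expnS. Qed.

(** The number of blocks follows the recursion of [ack]: [top] has block length [size bot]. The
    factor 2 in the bound absorbs the doubling and also gives [size bot + 1 <= 2 * size bot], the
    shift needed in the argument. *)
Lemma exists_good4 i j : exists bs, [/\ good (2 ^ i) 5 j bs, 0 < size bs
  & 2 * size bs <= ack i.+1 j.+1].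
Proof.
elim: i j => [|i IHi] j.
  exists [:: iota 0 j]; split=> //; first exact: good_one.
  by have := ack_gt 0 j.+1; rewrite /size; lia.
elim: j => [|j [bot [gb b0 bb]]]; first by exists [:: [::]]; split=> //; exact: good_nil.
have [top [gt t0 tb]] := IHi (size bot).
exists (shuffle bot 0 (replace mirror [::] top)).
split; first by rewrite expnS; apply: good_mirror; rewrite -?expnS.
  by rewrite size_shuffle size_replace_mirror !muln_gt0 t0 b0.
rewrite size_shuffle size_replace_mirror ackSS // -!mulnA.
rewrite (_ : 2 * _ = (2 * size bot) * (2 * size top)); last by lia.
apply: leq_mul => //; apply: leq_trans tb _; apply: ack_mono; lia.
Qed.

(** * Multiplicity and number of blocks in order 5 *)

Fixpoint mult5 (i : nat) : nat :=
  if i is i'.+1 then 2 * mult5 i' + 2 ^ i'.+1 - 3 else 1.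

Lemma mult5E i : mult5 i + 2 * 2 ^ i = i * 2 ^ i + 3.
Proof.
(* Positivity is carried along so that the truncated subtraction of 3 is exact. *)
suff [//] : mult5 i + 2 * 2 ^ i = i * 2 ^ i + 3 /\ 0 < mult5 i.
elim: i => // i [IH p] /=; have := expn_gt0 2 i; rewrite expnS mulSn /= => e.
by rewrite mulnCA; move: (i * 2 ^ i) (2 ^ i) (mult5 i) IH p e => A E c; lia.
Qed.

Lemma mult5_gt0 i : 0 < mult5 i.
Proof.
elim: i => // i IH /=; have := leq_pexp2l (isT : 0 < 2) (ltn0Sn i); rewrite expn1; lia.
Qed.

Lemma mult5_le i : mult5 i <= 2 ^ i * 2 ^ i.
Proof.
elim: i => // i IH /=; have := expn_gt0 2 i; rewrite expnS /=; nia.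
Qed.

Lemma cube_lt_exp y : 10 <= y -> y * y * y < 2 ^ y.
Proof.
move=> y10; rewrite -(subnK y10); elim: (y - 10) => [|n IH]; first by [].
rewrite addSn expnS; move: (n + 10) (leq_addl n 10) IH => z hz.
have h1 : 10 * z <= z * z by rewrite leq_mul2r hz orbT.
have h2 : 10 * (z * z) <= z * z * z by rewrite -mulnA leq_mul2r hz orbT.
move: (2 ^ z) => E IH.
have e : z.+1 * z.+1 * z.+1 = z * z * z + 3 * (z * z) + 3 * z + 1 by lia.
rewrite e; lia.
Qed.

(** One step of [j] is paid for by three steps in the second argument of [ack]. The first covers the
    number of blocks of [U], the second the long blocks required of [top], the third the number of
    blocks of [top]. *)
Lemma exists_good5 i j : exists bs, [/\ good (mult5 i) 6 j bs, 0 < size bs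
  & size bs < ack i.+2 (3 * j + 2)].
Proof.
elim: i j => [|i IHi] j.
  exists [:: iota 0 j]; split=> //; first exact: good_one.
  by apply: leq_ltn_trans (ack_gt _ _); rewrite /=; lia.
elim: j => [|j [bot [gb w0 wY]]].
  exists [:: [::]]; split=> //; first exact: good_nil.
  by apply: leq_ltn_trans (ack_gt _ _).
have [U [gU U0 Ub]] := exists_good4 i.+1 (size bot).
(* The block length that [good_split] asks for: the multiplicity of [top] times the loss per
   block. *)
set jt := mult5 i * (2 ^ i.+1 * nsym (flatten U) + 2 * size bot).
have [top [gt t0 tb]] := IHi jt.
have P1 : 1 < 2 ^ i.+1 by rewrite -{1}(expn0 2) ltn_exp2l.
have [gs s0] := good_split (mult5_gt0 i) P1 w0 U0 gU gb gt t0.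
set sub := replace _ _ _ in gs s0.
exists (shuffle bot 0 sub); split=> //; first by rewrite size_shuffle muln_gt0 s0 w0.
rewrite size_shuffle; have [_ st _ _ _] := gt; have [_ sU _ _ cU] := gU.
have sb := size_replace_split U (size bot) st; rewrite -/sub in sb.
rewrite (size_flatten_const sU) in cU.
have -> : 3 * j.+1 + 2 = (3 * j + 2).+3 by lia.
set Y := ack i.+3 (3 * j + 2) in wY *.
have j0 : 0 < 3 * j + 2 by lia.
rewrite (ackSS _ (ltn0Sn _)); set Y2 := ack i.+3 _.+2.
set Z := ack i.+2 Y; set Y1 := Y * Z.
have Y2E : Y2 = Y1 * ack i.+2 Y1 by rewrite /Y2 ackSS // ackSS.
have Yge : 2 ^ i.+4 <= Y by rewrite -ack_2; apply: ack_mono; lia.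
have Y16 : 16 <= Y by apply: leq_trans Yge; rewrite -[16]/(2 ^ 4) leq_exp2l.
have D : mult5 i <= Y * Y.
  apply: leq_trans (mult5_le i) _; apply: leq_mul; apply: leq_trans Yge; rewrite leq_exp2l //; lia.
have zZ : 2 * size U <= Z by apply: leq_trans Ub (ack_mono _ _).
have YZ : Y < Z by exact: ack_gt.
have UZ : size U + 2 <= Z by lia.
have w_le : size bot <= Y by exact: ltnW.
(* By [cU] the product of [2 ^ i.+1] and the number of symbols of [U] is at most the length of [U],
   so the second factor of [jt] is at most [(size U + 2) * size bot]. *)
have jtY : jt <= Y * Y * (Y * Z).
  apply: leq_mul => //; apply: leq_trans (leq_mul w_le UZ).
  by rewrite mulnDr mulnC in cU *; lia.
have Y1_10 : 10 <= Y1 by rewrite /Y1; nia.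
have cube := cube_lt_exp Y1_10.
have Y2big : Y1 * 2 ^ Y1 <= Y2 by rewrite Y2E leq_mul2l ack_exp orbT.
have YY1 : Y * Y <= Y1 * Y1 by rewrite leq_mul // /Y1 leq_pmulr //; lia.
have jtY1 : jt <= Y1 * Y1 * Y1 by apply: leq_trans jtY _; rewrite leq_mul.
have quart : Y1 * Y1 * Y1 * Y1 < Y2.
  by apply: leq_trans Y2big; rewrite mulnC ltn_mul2l cube andbT; lia.
have topb : size top <= ack i.+2 Y2.
  apply: leq_trans (ltnW tb) _; apply: ack_mono.
  by move: (Y1 * Y1 * Y1) quart jtY1 cube => q; nia.
have A0 := ack_gt0 i.+1 Y2.
apply: (@leq_ltn_trans (ack i.+2 Y2 * (Y1 * Y1 * Y1 * Y1))); last first.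
  by rewrite mulnC ltn_mul2r A0.
apply: leq_trans (leq_mul sb (leqnn _)) _.
have UwY : (size U + 2) * size bot <= Y1 by rewrite mulnC leq_mul.
have := leq_mul topb (leq_mul jtY1 UwY); rewrite !mulnA.
exact.
Qed.

(** Unfolding two levels turns the right side into [w * (v * ack i.+2 v)]. These factors dominate
    [2 ^ (i + 5)], [i + 5] and the first factor on the left. The assumption [3 <= J] gives
    [w >= ack i.+4 2 = 2 ^ (i + 5)]; it is met through the maximum with 3 in [alpha2]. *)
Lemma ack_final i J : 3 <= J ->
  ack i.+2 (3 * (mult5 i * J) + 2) * ((i + 5) * 2 ^ (i + 5)) <= ack i.+4 J.
Proof.
case: J => [//|J]; rewrite ltnS => J2; rewrite ackSS; last by lia.
set w := ack i.+4 J.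
have w1 : 2 ^ (i + 5) <= w by rewrite addnC -ack_2; apply: ack_mono.
have w2 : 2 ^ J <= w by exact: ack_exp.
have i5 := ltn_expl (i + 5) (ltnSn 1).
have w3 : w = w.-1.+1 by rewrite prednK // ack_gt0.
have wp : 0 < w.-1 by lia.
have -> : ack i.+3 w = ack i.+3 w.-1 * ack i.+2 (ack i.+3 w.-1).
  by rewrite -ackSS // prednK // ack_gt0.
set v := ack i.+3 w.-1.
have v1 : 2 ^ w.-1 <= v by exact: ack_exp.
have v2 : w.-1 < v := ack_gt _ _.
have e1 : 32 * (i + 1) <= 2 ^ (i + 5).
  by rewrite expnD mulnC leq_mul2r addn1 ltn_expl ?orbT.
have e2 : 2 * J <= 2 ^ J.
  by case: (J) J2 => // J' _; rewrite expnS leq_mul2l ltn_expl ?orbT.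
have v3 : 3 * (mult5 i * J.+1) + 2 <= v.
  apply: leq_trans v1; apply: (@leq_trans (2 ^ (i + i + J.+2))); last first.
    by rewrite leq_exp2l //; lia.
  rewrite !expnD; have := mult5_le i; have : 0 < 2 ^ i by rewrite expn_gt0.
  have : 3 * J.+1 + 2 <= 2 ^ J.+2.
    by have := ltn_expl J (ltnSn 1); rewrite !expnS; lia.
  move: (2 ^ J.+2) (2 ^ i) (mult5 i) => E p c h p0 hc.
  apply: (@leq_trans (p * p * (3 * J.+1 + 2))); last by rewrite leq_mul2l h orbT.
  have := leq_mul hc (leqnn J.+1); move: (c * J.+1) => y; rewrite mulnDr; nia.
rewrite mulnC [(i + 5) * _]mulnC -mulnA.
apply: leq_mul => //; apply: leq_mul; first by lia.
exact: ack_mono.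
Qed.

(** * Lower bounds *)

Lemma no_alt7 s : alt_le 6 s -> ~ has_alt7 s.
Proof.
move=> A6 [a [b [ab /(alt_len_subseq a b)]]]; apply/negP; rewrite -ltnNge.
apply: leq_trans (_ : 7 <= _); first exact: A6.
by rewrite /= !eqxx.
Qed.

Lemma ceil_div_le X K L : 0 < K -> (ceil_div X K <= L) = (X <= K * L).
Proof.
move=> K0; rewrite /ceil_div -ltnS ltn_divLR // mulSn mulnC; lia.
Qed.

Lemma alpha2_min n m i : i.+2 <= alpha2 n m -> ack i.+1 (maxn (ceil_div n m) 3) < m.
Proof.
rewrite /alpha2 ltnS; set p := fun k => _ => h.
have := before_find 0 h; rewrite nth_iota; last first.
  by apply: leq_trans h _; rewrite -[X in _ <= X](size_iota 0 m.+1) find_size.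
by rewrite add0n /p ltnNge => ->.
Qed.

Lemma lambda5_nm_iota n m : 0 < m -> lambda5_nm_ge n m n.
Proof.
move=> m0; exists (iota 0 n); rewrite size_iota; split=> //; split.
- by rewrite /at_most_symbols undup_id ?iota_uniq // size_iota.
- by exists [:: iota 0 n]; rewrite /= iota_uniq cats0.
- have [_ _ _ A _] := @good_one 6 n isT; rewrite /= cats0 in A; exact: no_alt7.
Qed.

Lemma lambda5_nm_const n m : 0 < n -> lambda5_nm_ge n m m.
Proof.
move=> n0; exists (nseq m 0); rewrite size_nseq; split=> //; split.
- rewrite /at_most_symbols; apply: leq_trans n0.
  apply: (@uniq_leq_size _ _ [:: 0]); first exact: undup_uniq.
  by move=> x; rewrite mem_undup mem_nseq inE => /andP[].
- exists (nseq m [:: 0]); rewrite size_nseq all_nseq orbT; split=> //.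
  by elim: m => //= m ->.
apply: no_alt7 => a b ab; have [a0|a0] := eqVneq a 0; last first.
  by rewrite alt_len_notin // mem_nseq (negPf a0) andbF.
apply: (@leq_trans 1) => //; apply: alt_len_notin2; rewrite mem_nseq -a0 eq_sym (negPf ab).
by rewrite andbF.
Qed.

Lemma lambda5_nm_le n m L L' : L' <= L -> lambda5_nm_ge n m L -> lambda5_nm_ge n m L'.
Proof. by move=> LL [s [D h]]; exists s; split=> //; apply: leq_trans LL h. Qed.

(** Disjoint copies of [bs] arise by shuffling it with [k] empty blocks. *)
Lemma lambda5_nm_copies c j bs n m k : good c 6 j bs -> k * size bs <= m ->
  k * nsym (flatten bs) <= n -> lambda5_nm_ge n m (k * (size bs * j)).
Proof.
move=> [ub sb _ A _] km kn; exists (flatten (shuffle bs 0 (nseq k [::]))).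
have e : flatten (nseq k [::]) = [::] :> seq nat by elim: k {km kn}.
have all_le w : all (fun B : seq nat => size B <= w) (nseq k [::]).
  by rewrite all_nseq orbT.
rewrite size_flatten_shuffle // e size_nseq add0n (size_flatten_const sb).
split=> //; split.
- apply: leq_trans kn; rewrite -/(nsym _); apply: leq_trans (nsym_shuffle _ _) _.
  by rewrite e size_nseq.
- exists (shuffle bs 0 (nseq k [::])); split=> //; last exact: shuffle_uniq.
  by rewrite size_shuffle size_nseq.
apply/no_alt7/shuffle_alt => //; first by rewrite e.
by rewrite all_nseq orbT.
Qed.

(** With p = 2^i and [mult5 i] = (i - 2) p + 3 the claim is 32 i p + 160 p <= 64 i p - 128 p + 192,
    for which i >= 9 suffices. *)
Lemma alpha_mult5 i : 14 <= i + 5 -> (i + 5) * 2 ^ (i + 5) <= 64 * mult5 i.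
Proof.
move=> h; rewrite expnD (_ : 2 ^ 5 = 32) //; have := mult5E i; have := expn_gt0 2 i => /=.
move: (2 ^ i) (mult5 i) => p c p0 e.
have : 9 * p <= i * p by rewrite leq_mul2r; lia.
have -> : (i + 5) * (p * 32) = 32 * (i * p) + 160 * p by lia.
lia.
Qed.

Lemma lambda5_nm_lower : exists2 K, 0 < K & forall n m, 0 < n -> 0 < m ->
  lambda5_nm_ge n m (ceil_div (n * alpha2 n m * 2 ^ alpha2 n m) K).
Proof.
(* 256 = 4 * 64: a factor 2 for each of the two rounded quotients [J] and [k], and 64 from
   [alpha_mult5]. The other bound covers [lev < 14]. *)
have [K [K1 K2]] : exists K, 256 <= K /\ 14 * 2 ^ 14 <= K.
  by exists (256 + 14 * 2 ^ 14); rewrite leq_addr leq_addl.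
have K0 : 0 < K by apply: leq_trans K1.
exists K => // n m n0 m0; rewrite -mulnA; set lev := alpha2 n m.
set X := n * _.
have le L : X <= K * L -> lambda5_nm_ge n m L -> lambda5_nm_ge n m (ceil_div X K).
  by move=> h; apply: lambda5_nm_le; rewrite ceil_div_le.
have [small|large] := ltnP lev 14.
  apply: (le n); last exact: lambda5_nm_iota.
  rewrite /X mulnC leq_mul2r; apply/orP; right; apply: leq_trans K2.
  by apply: leq_mul; rewrite ?leq_exp2l // ltnW.
have [i ei] : exists i, i + 5 = lev by exists (lev - 5); lia.
have amin : ack i.+4 (maxn (ceil_div n m) 3) < m.
  by apply: alpha2_min; rewrite -/lev; lia.
have [mX|Xm] := leqP X m.
  by apply: (le m); [apply: leq_trans mX _; rewrite leq_pmull | exact: lambda5_nm_const].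
(* Capping [m] at [n] keeps the quotient [J] positive when there are more blocks than symbols. *)
set J0 := maxn _ _ in amin; set m' := minn n m; pose J := n %/ m'.
have m'0 : 0 < m' by rewrite leq_min n0.
have J_gt0 : 0 < J by rewrite divn_gt0 // geq_minl.
have JJ0 : J <= J0.
  rewrite /J /m' /J0; have [nm|mn] := leqP n m.
    by rewrite divnn n0 leq_max orbT.
  by rewrite leq_max leq_div2r // leq_addr.
(* With block length [mult5 i * J], multiplicity [mult5 i] leaves at most [J] symbols per block, so
   about [m'] blocks use at most [n] symbols. *)
have [bs [gbs b0 bb]] := exists_good5 i (mult5 i * J).
have c0 := mult5_gt0 i.
have fin := ack_final i (leq_maxr (ceil_div n m) 3); rewrite -/J0 ei in fin.
have Bal : size bs * (lev * 2 ^ lev) < m.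
  apply: leq_ltn_trans amin; apply: leq_trans fin; apply: leq_mul => //.
  apply: leq_trans (ltnW bb) _; apply: ack_mono.
  by rewrite leq_add2r !leq_mul2l JJ0 !orbT.
have al0 : 0 < lev * 2 ^ lev by rewrite muln_gt0 expn_gt0 andbT; lia.
(* The spare factor in [Bal] gives [size bs <= m], and cancelled against m < n * (lev * 2 ^ lev) it
   gives [size bs <= n]. *)
have Bm' : size bs <= m'.
  rewrite leq_min; apply/andP; split.
    by rewrite ltnW // -(ltn_pmul2r al0); apply: ltn_trans Bal Xm.
  by apply: leq_trans (ltnW Bal); rewrite leq_pmulr.
pose k := m' %/ size bs.
have k0 : 0 < k by rewrite divn_gt0.
have kB : k * size bs <= m' by exact: leq_divM.
have [_ sb _ _ cn] := gbs.
have nB : nsym (flatten bs) <= size bs * J.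
  by rewrite -(leq_pmul2l c0); apply: leq_trans cn _; rewrite (size_flatten_const sb) mulnCA.
apply: (le (k * (size bs * (mult5 i * J)))); last first.
  apply: lambda5_nm_copies gbs _ _; first by apply: leq_trans kB (geq_minr _ _).
  apply: leq_trans (_ : k * (size bs * J) <= _); first by rewrite leq_mul2l nB orbT.
  rewrite mulnA; apply: leq_trans (leq_divM n m'); rewrite -/J mulnC leq_mul2l kB orbT //.
have h1 : n <= 2 * (J * m').
  have := ltn_ceil n m'0; rewrite -/J mulSn; have := leq_pmull m' J_gt0; lia.
have h2 : m' <= 2 * (k * size bs).
  have := ltn_ceil m' b0; rewrite -/k mulSn; have := leq_pmull (size bs) k0; lia.
have h3 : lev * 2 ^ lev <= 64 * mult5 i by rewrite -ei; apply: alpha_mult5; rewrite ei.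
have h4 : n <= 4 * (J * (k * size bs)).
  apply: leq_trans h1 _; have := leq_mul (leqnn J) h2; rewrite mulnCA; lia.
apply: leq_trans (leq_mul h4 h3) _.
apply: (@leq_trans (256 * (k * (size bs * (mult5 i * J))))); last by rewrite leq_mul2r K1 orbT.
by rewrite leq_eqVlt; apply/orP; left; apply/eqP; rewrite mulnACA; congr (_ * _); rewrite -!mulnA; lia.
Qed.

(** * Removal of adjacent repetitions and the bound for one parameter *)

Fixpoint squeeze (x : nat) (s : seq nat) : seq nat :=
  if s is y :: s' then if y == x then squeeze x s' else y :: squeeze y s' else [::].

Lemma squeeze_path x s : path (fun y z => y != z) x (squeeze x s).
Proof.
elim: s x => //= y s IH x; case: eqP => [_|/eqP yx]; first exact: IH.
by rewrite /= eq_sym yx IH.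
Qed.

Lemma squeeze_subseq x s : subseq (squeeze x s) s.
Proof.
elim: s x => // y s IH x; rewrite [squeeze _ _]/=; case: eqP => _.
  exact: subseq_trans (IH x) (subseq_cons _ _).
by rewrite /= eqxx.
Qed.

Lemma squeeze_uniq_cat x s t : uniq (x :: s) ->
  squeeze x (s ++ t) = s ++ squeeze (last x s) t.
Proof.
elim: s x => //= y s IH x; rewrite inE negb_or eq_sym => /and3P[/andP[/negPf-> _] ys us].
by rewrite IH //= ys.
Qed.

(** Only the first entry of a block without repetitions can equal its predecessor, so each block
    loses at most one entry. *)
Lemma size_squeeze_blocks x (bs : seq (seq nat)) : all uniq bs ->
  size (flatten bs) <= size (squeeze x (flatten bs)) + size bs.
Proof.
elim: bs x => // B bs IH x /andP[uB ubs].
case: B uB => [|y B] uB; first by apply: leq_trans (IH x ubs) _; rewrite leq_add2l /=.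
have h := squeeze_uniq_cat (flatten bs) uB; have := IH (last y B) ubs.
rewrite /= size_cat; case: eqP => [<-|_]; rewrite /= h size_cat => le.
  by rewrite addnS ltnS -addnA leq_add2l.
by rewrite addSn addnS ltnS leqW // -addnA leq_add2l.
Qed.

Lemma lambda5_iota n : lambda5_ge n n.
Proof.
exists (iota 0 n); rewrite size_iota; split=> //; split.
- by rewrite /at_most_symbols undup_id ?iota_uniq // size_iota.
- move=> i; rewrite size_iota => h; rewrite !nth_iota // ?(ltnW h) //; lia.
- have [_ _ _ A _] := @good_one 6 n isT; rewrite /= cats0 in A; exact: no_alt7.
Qed.

Lemma lambda5_of_blocks n m L : lambda5_nm_ge n m L -> lambda5_ge n (L - m).
Proof.
(* The starting value 0 also deletes a leading 0, which is charged to its block. *)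
move=> [s [[sn [bs [bm ub E]] A] Ls]]; subst s; exists (squeeze 0 (flatten bs)).
have ss := squeeze_subseq 0 (flatten bs).
split; last by have := size_squeeze_blocks 0 ub; lia.
split.
- exact: leq_trans (nsym_sub (mem_subseq ss)) sn.
- move=> i h; have /pathP := squeeze_path 0 (flatten bs).
  by move=> /(_ 0 i.+1 h).
- by case=> a [b [ab h]]; apply: A; exists a, b; split=> //; apply: subseq_trans h ss.
Qed.

Theorem mainTheorem12 :
  (exists K N : nat, 0 < K /\
     forall n m : nat, N <= n -> N <= m ->
       lambda5_nm_ge n m (ceil_div (n * alpha2 n m * 2 ^ alpha2 n m) K)) /\
  (exists K N : nat, 0 < K /\
     forall n : nat, N <= n ->
       lambda5_ge n (ceil_div (n * alpha n * 2 ^ alpha n) K)).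
Proof.
have [K K0 H] := lambda5_nm_lower; split; first by exists K, 1; split.
exists (2 * K), 1; split; first by rewrite muln_gt0.
move=> n n0; have := H n n n0 n0; rewrite -/(alpha n) -mulnA; set X := _ * _ => hX.
have le L : X <= 2 * K * L -> lambda5_ge n L -> lambda5_ge n (ceil_div X (2 * K)).
  move=> h [s [D hs]]; exists s; split=> //; apply: leq_trans hs.
  by rewrite ceil_div_le // muln_gt0.
(* The removal of repetitions costs at most [n]. Above the threshold, [n] is at most X / (2 K), half
   of X / K; below it, [n] distinct symbols suffice. *)
have [large|small] := leqP (2 * K) (alpha n * 2 ^ alpha n); last first.
  by apply: (le n); [rewrite /X mulnC leq_mul2r ltnW ?orbT | exact: lambda5_iota].
apply: le (lambda5_of_blocks hX).
have h1 : X <= K * ceil_div X K by rewrite -ceil_div_le.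
have h2 : 2 * K * n <= X by rewrite /X mulnC leq_mul2l large orbT.
by rewrite mulnBr -mulnA; lia.
Qed.
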